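(* The affine Weyl quantization $A_g$ of $g\in\mathscr{S}(\mathrm{Aff})$ can be written as $$A_g=g\star_{\mathrm{Aff}}P_{\mathrm{Aff}}.$$ Moreover, for $\phi,\psi\in\mathscr{S}(\mathbb{R}_+)$, the affine Weyl symbol $W^{\psi,\phi}_{\mathrm{Aff}}$ of the rank-one operator $\psi\otimes\phi$ can be written as $$W^{\psi,\phi}_{\mathrm{Aff}}=(\psi\otimes\phi)\star_{\mathrm{Aff}}P_{\mathrm{Aff}}.$$
   Context: $\mathrm{Aff}=\mathbb{R}\times\mathbb{R}_+$, $\mathbb{R}_+=(0,\infty)$, is the affine group with $(x,a)\cdot(y,b)=(ay+x,ab)$ and identity $(0,1)$; right translation is $(R_{(x,a)}h)(y,b)=h((y,b)\cdot(x,a))$. $L^2(\mathbb{R}_+)=L^2(\mathbb{R}_+,r^{-1}dr)$, $U(x,a)\psi(r)=e^{2\pi i xr}\psi(ar)$, and $(\psi\otimes\phi)(\xi)=\langle\xi,\phi\rangle_{L^2(\mathbb{R}_+)}\psi$. $\mathscr{S}(\mathbb{R}_+)$: smooth $\psi$ on $\mathbb{R}_+$ with $x\mapsto\psi(e^x)$ in $\mathscr{S}(\mathbb{R})$. $\mathscr{S}(\mathrm{Aff})$: smooth $f$ on $\mathrm{Aff}$ with $(x,\omega)\mapsto f(x,e^\omega)$ in $\mathscr{S}(\mathbb{R}^2)$. $\mathscr{S}'(\mathbb{R}_+)$ and $\mathscr{S}'(\mathrm{Aff})$ denote the continuous anti-linear functionals on these spaces, and a function $g\in\mathscr{S}(\mathrm{Aff})$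 is identified with the functional $h\mapsto\int_{\mathrm{Aff}}g\,\overline{h}\,\frac{dx\,da}{a}$. With $\lambda(u)=\frac{ue^u}{e^u-1}$ ($\lambda(0)=1$), $W^{\psi,\phi}_{\mathrm{Aff}}(x,a)=\int_{-\infty}^\infty\psi(a\lambda(u))\overline{\phi(a\lambda(-u))}e^{-2\pi i xu}\,du$, which belongs to $\mathscr{S}(\mathrm{Aff})$ for $\psi,\phi\in\mathscr{S}(\mathbb{R}_+)$. For $f\in\mathscr{S}'(\mathrm{Aff})$, the affine Weyl quantization $A_f:\mathscr{S}(\mathbb{R}_+)\to\mathscr{S}'(\mathbb{R}_+)$ is defined by $\langle A_f\psi,\phi\rangle_{\mathscr{S}',\mathscr{S}}=\langle f,W^{\phi,\psi}_{\mathrm{Aff}}\rangle_{\mathscr{S}',\mathscr{S}}$; $f$ is the (unique) affine Weyl symbol of $A_f$. The affine parity operator is $P_{\mathrm{Aff}}=A_{\delta_{(0,1)}}$, where $\langle\delta_{(0,1)},h\rangle=\overline{h(0,1)}$. Equivalently $\langle P_{\mathrm{Aff}}\psi,\phi\rangle=W^{\psi,\phi}_{\mathrm{Aff}}(0,1)=\int_{-\infty}^\infty\psi(\lambda(u))\overline{\phi(\lambda(-u))}\,du$; this absolutely convergent integral also defines the pairing when $\psi,\phi$ are replaced by $U(-x,a)\psi,U(-x,a)\phi$. Convolutions with $P_{\mathrm{Aff}}$: for $g\in\mathscr{S}(\mathrm{Aff})$, $g\star_{\mathrm{Aff}}P_{\mathrm{Aff}}$ is the operator $\mathscr{S}(\mathbb{R}_+)\to\mathscr{S}'(\mathbb{R}_+)$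 whose affine Weyl symbol is the functional $$h\mapsto\Big\langle\delta_{(0,1)},\int_{\mathrm{Aff}}\overline{g(x,a)}\,R_{(x,a)}h\,\frac{dx\,da}{a}\Big\rangle=\overline{\Big(\int_{\mathrm{Aff}}\overline{g(x,a)}\,R_{(x,a)}h\,\frac{dx\,da}{a}\Big)(0,1)},\qquad h\in\mathscr{S}(\mathrm{Aff}).$$ For $\psi,\phi\in\mathscr{S}(\mathbb{R}_+)$, $\big((\psi\otimes\phi)\star_{\mathrm{Aff}}P_{\mathrm{Aff}}\big)(x,a):=\langle P_{\mathrm{Aff}}U(-x,a)\psi,U(-x,a)\phi\rangle$. *)

(* Defs.v *)
From HB Require Import structures.
From mathcomp Require Import all_boot all_order all_algebra.
From mathcomp Require Import all_classical all_reals all_analysis.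
From mathcomp Require Export complex.

Set Implicit Arguments.
Unset Strict Implicit.
Unset Printing Implicit Defensive.

Import Order.TTheory GRing.Theory Num.Theory.
Import numFieldNormedType.Exports.

Local Open Scope classical_set_scope.
Local Open Scope ring_scope.
Local Open Scope complex_scope.

(* A function on (0, +oo), resp. on Aff = R x (0, +oo), is encoded as a total
   function on R, resp. R * R, whose values outside that set are never used:
   equalities, integrals, smoothness and decay only involve points with
   positive (second) coordinate. *)

Section ComplexCalculus.
Context {R : realType}.

Definition cderivable (f : R -> R[i]) (t : R) : Prop :=
  derivable (fun s => complex.Re (f s)) t 1 /\ derivable (fun s => complex.Im (f s)) t 1.

Definition cderive (f : R -> R[i]) (t : R) : R[i] :=
  (derive1 (fun s => complex.Re (f s)) t) +i* (derive1 (fun s => complex.Im (f s)) t).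

Definition cintegral (d : measure_display) (T : measurableType d)
    (mu : {measure set T -> \bar R}) (D : set T) (f : T -> R[i]) : R[i] :=
  Rintegral mu D (fun t => complex.Re (f t)) +i* Rintegral mu D (fun t => complex.Im (f t)).

Definition cis (t : R) : R[i] := cos t +i* sin t.

Definition pderiv1 (f : R * R -> R[i]) : R * R -> R[i] :=
  fun p => cderive (fun s => f (s, p.2)) p.1.

Definition pderiv2 (f : R * R -> R[i]) : R * R -> R[i] :=
  fun p => cderive (fun s => f (p.1, s)) p.2.

(* Iterated partial derivative along a word: [false] is the first variable,
   [true] the second one; the head of the word is differentiated last. *)
Definition pderivs (w : seq bool) (f : R * R -> R[i]) : R * R -> R[i] :=
  foldr (fun b g => if b then pderiv2 g else pderiv1 g) f w.

(* C^oo on an open set. *)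
Definition smooth1 (D : set R) (f : R -> R[i]) : Prop :=
  forall n t, D t -> cderivable (iter n cderive f) t.

(* C^oo on an open set of the plane: the iterated partial derivatives of all
   orders, in any order of the variables, exist and are continuous. *)
Definition smooth2 (D : set (R * R)) (f : R * R -> R[i]) : Prop :=
  forall (w : seq bool) p, D p ->
    [/\ {for p, continuous (fun q => complex.Re (pderivs w f q))},
        {for p, continuous (fun q => complex.Im (pderivs w f q))},
        cderivable (fun s => pderivs w f (s, p.2)) p.1
      & cderivable (fun s => pderivs w f (p.1, s)) p.2].

Definition schwartz1 (f : R -> R[i]) : Prop :=
  smooth1 setT f /\
  forall k n : nat, exists C : R, forall t : R,
    `|t| ^+ k * Normc.normc (iter n cderive f t) <= C.

(* [seminorm2_le k l m n f C]:
   sup_(x, y) |x|^k |y|^l |d_x^m d_y^n f (x, y)| <= C *)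
Definition seminorm2_le (k l m n : nat) (f : R * R -> R[i]) (C : R) : Prop :=
  forall x y : R,
    `|x| ^+ k * `|y| ^+ l * Normc.normc (iter m pderiv1 (iter n pderiv2 f) (x, y))
      <= C.

Definition schwartz2 (f : R * R -> R[i]) : Prop :=
  smooth2 setT f /\
  forall k l m n : nat, exists C : R, seminorm2_le k l m n f C.

End ComplexCalculus.

Section AffineGroup.
Context {R : realType}.
Local Notation leb := (@lebesgue_measure R).

Definition Rpos : set R := [set r | 0 < r].
Definition Aff : set (R * R) := [set p | 0 < p.2].

Definition aff_mul (p q : R * R) : R * R := (p.2 * q.1 + p.1, p.2 * q.2).
Definition aff_one : R * R := (0, 1).
Definition rtrans (q : R * R) (h : R * R -> R[i]) : R * R -> R[i] :=
  fun p => h (aff_mul p q).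

(* The measure dx da / a, a right Haar measure of Aff. *)
Definition aff_integral (F : R * R -> R[i]) : R[i] :=
  cintegral (leb \x leb)%E Aff (fun p => F p * (p.2^-1)%:C).

(* Inner product of L^2((0, +oo), dr / r), linear in the first argument. *)
Definition inner_Rpos (psi phi : R -> R[i]) : R[i] :=
  cintegral leb Rpos (fun r => psi r * conjc (phi r) * (r^-1)%:C).

Definition U (x a : R) (psi : R -> R[i]) : R -> R[i] :=
  fun r => cis (2 * pi * x * r) * psi (a * r).

Definition schwartz_Rpos (psi : R -> R[i]) : Prop :=
  smooth1 Rpos psi /\ schwartz1 (fun t => psi (expR t)).

Definition log_coord (h : R * R -> R[i]) : R * R -> R[i] :=
  fun p => h (p.1, expR p.2).

Definition schwartz_Aff (h : R * R -> R[i]) : Prop :=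
  smooth2 Aff h /\ schwartz2 (log_coord h).

(* A functional on S(Aff) is encoded as a total map on functions, of which only
   the values on S(Aff) matter; [tempered_Aff f] says that f is an element of
   S'(Aff), i.e. anti-linear and continuous on S(Aff) for the topology
   generated by the Schwartz seminorms (in the coordinates (x, log a)). *)
Definition functional_Aff : Type := (R * R -> R[i]) -> R[i].

Definition antilinear_Aff (f : functional_Aff) : Prop :=
  forall (c : R[i]) (h1 h2 : R * R -> R[i]),
    schwartz_Aff h1 -> schwartz_Aff h2 ->
    f (fun p => c * h1 p + h2 p) = conjc c * f h1 + f h2.

Definition continuous_Aff (f : functional_Aff) : Prop :=
  forall h0, schwartz_Aff h0 -> forall eps : R, 0 < eps ->
  exists (N : nat) (delta : R), 0 < delta /\
    forall h, schwartz_Aff h ->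
      (forall k l m n : nat, (k <= N)%N -> (l <= N)%N -> (m <= N)%N ->
         (n <= N)%N ->
         seminorm2_le k l m n (log_coord (fun p => h p - h0 p)) delta) ->
      Normc.normc (f h - f h0) <= eps.

Definition tempered_Aff (f : functional_Aff) : Prop :=
  antilinear_Aff f /\ continuous_Aff f.

Definition functional_of (g : R * R -> R[i]) : functional_Aff :=
  fun h => aff_integral (fun p => g p * conjc (h p)).

(* An operator T from S(R_+) to S'(R_+) is encoded by its pairing
   T psi phi = <T psi, phi>; only psi, phi in S(R_+) matter. *)
Definition operator : Type := (R -> R[i]) -> (R -> R[i]) -> R[i].

Definition eq_operator (S T : operator) : Prop :=
  forall psi phi, schwartz_Rpos psi -> schwartz_Rpos phi ->
    S psi phi = T psi phi.

Definition lam (u : R) : R :=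
  if u == 0 then 1 else u * expR u / (expR u - 1).

Definition wigner (psi phi : R -> R[i]) : R * R -> R[i] :=
  fun p => cintegral leb setT (fun u =>
    psi (p.2 * lam u) * conjc (phi (p.2 * lam (- u))) * cis (- (2 * pi * p.1 * u))).

Definition weyl_quant (f : functional_Aff) : operator :=
  fun psi phi => f (wigner phi psi).

Definition is_weyl_symbol (f : functional_Aff) (T : operator) : Prop :=
  tempered_Aff f /\ eq_operator T (weyl_quant f).

(* psi (x) phi : xi |-> <xi, phi> psi, a function on R_+ being identified with
   the functional eta |-> \int psi conj(eta) dr / r. *)
Definition rank_one (psi phi : R -> R[i]) : operator :=
  fun xi eta => inner_Rpos (fun r => inner_Rpos xi phi * psi r) eta.

Definition delta_one : functional_Aff := fun h => conjc (h aff_one).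

(* This unfolds to <P psi, phi> = conj (wigner phi psi (0, 1)), which the
   substitution u -> - u turns into \int psi (lam u) conj (phi (lam (- u))) du.
   The formula is also used at the functions U (- x) a psi, which in general
   are not in S(R_+) although the integral still converges absolutely. *)
Definition parity : operator := weyl_quant delta_one.

Definition conv_symbol (g : R * R -> R[i]) : functional_Aff :=
  fun h => delta_one (fun q => aff_integral (fun p => conjc (g p) * rtrans p h q)).

Definition conv_fun_parity (g : R * R -> R[i]) : operator :=
  weyl_quant (conv_symbol g).

Definition conv_rank_one_parity (psi phi : R -> R[i]) : R * R -> R[i] :=
  fun p => parity (U (- p.1) p.2 psi) (U (- p.1) p.2 phi).

End AffineGroup.

(* Main.v *)
Require Import Defs.
From mathcomp Require Import all_boot all_order all_algebra.
From mathcomp Require Import all_classical all_reals all_analysis.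
From mathcomp Require Import measurable_realfun ring lra.
Set Implicit Arguments.
Unset Strict Implicit.
Unset Printing Implicit Defensive.
Import Order.TTheory GRing.Theory Num.Theory.
Import numFieldNormedType.Exports.
Local Open Scope classical_set_scope.
Local Open Scope ring_scope.

(** The two statements about convolutions are formal.  Pairing delta at the
identity with the right translates of h returns h itself, so the symbol of
g * P is the functional of g ([weyl_quant_conv]); and the formula for W(x, a)
is the substitution u -> - u, in which the phases carried by U(- x, a)
recombine because lambda(u) - lambda(- u) = u ([wigner_parity]).

The substance is that W^{psi,phi} is a tempered symbol and quantizes to
psi (x) phi, i.e. the Moyal identity
  <W^{psi,phi}, W^{eta,xi}> = <psi, eta> <xi, phi>        ([moyal]).
Put a = e^w and lambda(u) = e^{l(u)}, so that lambda(- u) = e^{l(u) - u}.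
Then x |-> W^{psi,phi}(x, e^w) is the Fourier transform of the kernel
  K_w(u) = psi(e^{w + l(u)}) conj(phi(e^{w + l(u) - u})).
Plancherel's identity in x, for each w, turns the pairing into the integral of
K conj(L) over the (w, u)-plane.  The map (w, u) |-> (p, q) = (w + l(u),
w + l(u) - u) preserves Lebesgue measure, being a shift in w followed by a
shift and a reflection in u, and it splits the integrand into a function of p
times a function of q ([Rintegral_twist]).

Plancherel's identity is proved by Abel summation: the weight e^{-2 pi e |x|}
makes Fubini's theorem applicable and has the Poisson kernel as Fourier
transform; let e tend to 0, by monotone convergence on the frequency side and
by dominated convergence on the other side ([plancherel1]).  Monotone
convergence delivers square integrability of the transform together with the
identity, so the decay of W in x never has to be estimated; products of two
Wigner transforms are integrable because each of them is square integrable.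

Temperedness comes from a uniform bound on W: in logarithmic coordinates psi
and phi are dominated by (1 + t^2)^{-1}, whence |K_w(u)| <= C / (1 + u^2) for
every w ([lorentzM_le]).  Schwartz functions h on Aff are dominated by
(1 + x^2)^{-1} (1 + w^2)^{-1}, with a constant controlled by four seminorms.

All of this is carried out for real functions: a complex kernel is a pair of
real kernels, and the Fourier transform a pair of cosine and sine transforms.
*)

(** * Lebesgue measure under affine maps and under the logarithm *)

Section ChangeOfVariables.
Context {R : realType}.
Local Notation leb := (@lebesgue_measure R).
Local Open Scope ereal_scope.

(** Lebesgue measure is the only measure giving each half-open interval its
length, and the image of the scaled measure under an affine map does so. *)
Lemma ge0_integral_affine (e c : R) (f : R -> \bar R) : (0 < e)%R ->
  measurable_fun [set: R] f -> (forall x, 0 <= f x) ->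
  \int[leb]_x f (e * x + c)%R = (e^-1)%:E * \int[leb]_x f x.
Proof.
move=> e0 mf f0.
pose phi : measurableTypeR R -> measurableTypeR R := fun x => (e * x + c)%R.
have mphi : measurable_fun setT phi.
  apply: measurable_funD => //; exact: measurable_funM.
have ei0 : (0 <= e)%R by exact: ltW.
have E A : measurable A -> leb A = mscale (NngNum ei0) (pushforward leb phi) A.
  apply: lebesgue_measure_unique => _ [[a b] _ <-].
  change (leb `]a, b] = e%:E * leb (phi @^-1` `]a, b])).
  have -> : phi @^-1` `]a, b] = `]((a - c) / e)%R, ((b - c) / e)%R]%classic.
    apply/seteqP; split => x /=; rewrite !in_itv/= /phi => /andP[h1 h2];
      apply/andP; split; move: h1 h2;
      rewrite ?ltr_pdivrMr ?ler_pdivlMr ?ltr_pdivlMr ?ler_pdivrMr// => h1 h2; lra.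
  rewrite !lebesgue_measure_itv/= !lte_fin ltr_pM2r ?invr_gt0// ltrD2r.
  case: ifPn => _; last by rewrite mule0.
  rewrite -!EFinD -EFinM; congr EFin; field; exact: lt0r_neq0.
have -> : \int[leb]_x f x = e%:E * \int[leb]_x f (e * x + c)%R.
  rewrite (eq_measure_integral (mscale (NngNum ei0) (pushforward leb phi)));
    last by move=> A mA _; exact: E.
  rewrite ge0_integral_mscale// ge0_integral_pushforward//.
by rewrite muleA -EFinM mulVf ?mul1e// lt0r_neq0.
Qed.

Lemma integral_shift (c : R) (f : R -> \bar R) : measurable_fun [set: R] f ->
  \int[leb]_x f (x + c)%R = \int[leb]_x f x.
Proof.
move=> mf.
have H (g : R -> \bar R) : measurable_fun [set: R] g -> (forall x, 0 <= g x) ->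
    \int[leb]_x g (x + c)%R = \int[leb]_x g x.
  move=> mg g0; have := @ge0_integral_affine 1%R c g ltr01 mg g0.
  by under eq_integral do rewrite mul1r; rewrite invr1 mul1e.
rewrite integralE [RHS]integralE; congr (_ - _).
  rewrite -[RHS](H f^\+)//; [|exact: measurable_funepos].
  by apply: eq_integral => x _; rewrite !funeposE.
rewrite -[RHS](H f^\-)//; [|exact: measurable_funeneg].
by apply: eq_integral => x _; rewrite !funenegE.
Qed.

Lemma integral_oppr (f : R -> \bar R) : measurable_fun [set: R] f ->
  \int[leb]_x f (- x)%R = \int[leb]_x f x.
Proof.
move=> mf.
have H (g : R -> \bar R) : measurable_fun [set: R] g -> (forall x, 0 <= g x) ->
    \int[leb]_x g (- x)%R = \int[leb]_x g x.
  move=> mg g0.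
  rewrite -(@ge0_integral_pushforward _ _ (measurableTypeR R) (measurableTypeR R)
    R -%R _ leb setT g)//=.
  by apply: eq_measure_integral => //= A mA _; exact: lebesgue_measureN.
rewrite integralE [RHS]integralE; congr (_ - _).
  rewrite -[RHS](H f^\+)//; [|exact: measurable_funepos].
  by apply: eq_integral => x _; rewrite !funeposE.
rewrite -[RHS](H f^\-)//; [|exact: measurable_funeneg].
by apply: eq_integral => x _; rewrite !funenegE.
Qed.

Lemma integral_invr_itv (a b : R) : (0 < a)%R -> (a < b)%R ->
  \int[leb]_(r in `]a, b]) (r^-1)%:E = (ln b - ln a)%:E.
Proof.
move=> a0 ab.
have pos x : (a <= x)%R -> (0 < x)%R by exact: lt_le_trans.
have ci : {within `[a, b], continuous (fun r : R => r^-1%R)}.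
  apply: continuous_in_subspaceT => x; rewrite inE/= in_itv/= => /andP[ax _].
  by apply: inv_continuous; rewrite gt_eqF// pos.
rewrite integral_itv_obnd_cbnd; last first.
  apply/measurable_EFinP; apply: (@measurable_funS _ _ _ _ `[a, b]) => //.
    by apply: subset_itvr; rewrite bnd_simp.
  exact: subspace_continuous_measurable_fun.
rewrite (@continuous_FTC2 _ _ (@ln R))//.
- split.
  + move=> x; rewrite in_itv/= => /andP[/ltW/pos x0 _].
    by have [] := is_derive1_ln x0.
  + by apply: cvg_at_right_filter; exact: continuous_ln.
  + by apply: cvg_at_left_filter; apply: continuous_ln; rewrite pos// ltW.
- move=> x; rewrite in_itv/= => /andP[/ltW/pos x0 _].
  by rewrite derive1E; have [] := is_derive1_ln x0.
Qed.

(** The density 1 / r is the length of the vertical slice at r of the region D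
below the hyperbola s = 1 / r. Integration against dr / r is therefore
integration over D in the plane, and the image of planar measure on D under
(r, s) |-> ln r gives the interval ]a, b] the mass b - a. *)
Lemma ge0_integral_ln (f : R -> \bar R) :
  measurable_fun [set: R] f -> (forall x, 0 <= f x) ->
  \int[leb]_x f x = \int[leb]_(r in Rpos) (f (ln r) * (r^-1)%:E).
Proof.
move=> mf f0.
pose D : set (R * R) :=
  [set p | [&& (0 < p.1)%R, (0 < p.2)%R & (p.1 * p.2 < 1)%R]].
have mD : measurable D.
  have mb : measurable_fun [set: R * R]
      (fun p => [&& (0 < p.1)%R, (0 < p.2)%R & (p.1 * p.2 < 1)%R]).
    apply: measurable_and; first exact: measurable_fun_ltr.
    apply: measurable_and; apply: measurable_fun_ltr => //.
    exact: measurable_funM.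
  by rewrite -[D]setTI; exact: (mb measurableT [set true]).
pose m : {measure set (measurableTypeR R * measurableTypeR R) -> \bar R} :=
  mrestr (leb \x leb) mD.
pose phi : measurableTypeR R * measurableTypeR R -> measurableTypeR R :=
  fun p => ln p.1.
have mphi : measurable_fun setT phi by exact: measurableT_comp.
have slice (g : R -> \bar R) :
    measurable_fun [set: R] g -> (forall x, 0 <= g x) ->
    \int[leb \x leb]_(p in D) g (phi p) =
    \int[leb]_(r in Rpos) (g (ln r) * (r^-1)%:E).
  move=> mg g0.
  have restrE : (fun p => g (phi p)) \_ D = (fun p => g (phi p) * (\1_D p)%:E).
    apply/funext => p; rewrite patchE indicE; case: ifPn => _.
      by rewrite mule1.
    by rewrite mule0.
  rewrite integral_mkcond [RHS]integral_mkcond restrE fubini_tonelli1//=; last 2 first.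
    apply: emeasurable_funM; first exact: measurableT_comp.
    by apply/measurable_EFinP; exact: measurable_indic.
  - by move=> p; rewrite mule_ge0// lee_fin.
  apply: eq_integral => r _; rewrite /fubini_F/=.
  transitivity (g (ln r) * \int[leb]_s (\1_D (r, s))%:E).
    rewrite -ge0_integralZl//.
    apply/measurable_EFinP.
    exact: (measurableT_comp (measurable_indic mD)).
  rewrite patchE /Rpos; case: ifPn => [|].
    rewrite inE/= => r0; congr (_ * _).
    transitivity (\int[leb]_s (\1_(`]0%R, r^-1%R[%classic) s)%:E).
      apply: eq_integral => s _; rewrite !indicE; congr ((nat_of_bool _)%:R%:E).
      have e : ((r : R) * s < 1)%R = (s < r^-1)%R.
        by rewrite mulrC -ltr_pdivlMr// div1r.
      apply/idP/idP.
        move=> /set_mem/= /and3P[_ h1]; rewrite e => h2.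
        by apply/mem_set; rewrite /= in_itv/= h1 h2.
      move=> /set_mem; rewrite /= in_itv/= => /andP[h1]; rewrite -e => h2.
      by apply/mem_set; rewrite /D/=; apply/and3P.
    transitivity (leb `]0%R, r^-1%R[%classic).
      by rewrite integral_indic// setIT.
    by rewrite lebesgue_measure_itv/= lte_fin invr_gt0 r0 sube0.
  rewrite notin_setE/= => /negP; rewrite -leNgt => r0.
  rewrite integral0_eq ?mule0// => s _.
  rewrite indicE memNset//= => /andP[]; rewrite ltNge r0//.
have E A : measurable A -> leb A = pushforward m phi A.
  apply: lebesgue_measure_unique => _ [[a b] _ <-].
  change (leb `]a, b] = (leb \x leb) (phi @^-1` `]a, b] `&` D)).
  rewrite -integral_indic//; last first.
    rewrite -[X in measurable X]setTI; exact: mphi.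
  have [ba|ab] := leP b a.
    rewrite set_itv_ge ?bnd_simp -?leNgt//.
    rewrite measure0 preimage_set0 integral0_eq// => x _; by rewrite indic0.
  rewrite (slice (fun t => (\1_(`]a, b]%classic) t)%:E))//; last first.
    by apply/measurable_EFinP; exact: measurable_indic.
  rewrite lebesgue_measure_itv/= lte_fin ab.
  rewrite -EFinD -{1}(expRK b) -{1}(expRK a).
  rewrite -integral_invr_itv ?ltr_expR ?expR_gt0//.
  rewrite integral_mkcond [RHS]integral_mkcond; apply: eq_integral => r _.
  rewrite !patchE.
  have [|] := boolP (r \in Rpos).
    rewrite inE/Rpos/= => r0.
    have -> : (r \in `]expR a, expR b]%classic) = (ln r \in `]a, b]%classic).
      have e : (expR a < r <= expR b)%R = (a < ln r <= b)%R.
        by rewrite -{1 2}(lnK r0) ltr_expR ler_expR.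
      by apply/idP/idP => /set_mem/=; rewrite in_itv/= => h;
        apply/mem_set; rewrite /= in_itv/=; move: h; rewrite e.
    by rewrite indicE; case: ifPn => _; rewrite ?mul1e ?mul0e.
  rewrite notin_setE/Rpos/= => /negP; rewrite -leNgt => r0.
  rewrite memNset//= in_itv/= => /andP[h _].
  by have := lt_trans (expR_gt0 a) h; rewrite ltNge r0.
rewrite (eq_measure_integral (pushforward m phi)); last by move=> A mA _; exact: E.
rewrite ge0_integral_pushforward// preimage_setT.
rewrite -(slice f mf f0).
transitivity (\int[m]_(x in setT `\` ~` D) (f \o phi) x).
  apply: ge0_negligible_integral => //.
  - exact: measurableC.
  - exact: measurableT_comp.
  - by move=> p _; exact: f0.
  - change ((leb \x leb) (~` D `&` D) = 0).
    by rewrite setICl measure0.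
rewrite setTD setCK.
apply: eq_measure_integral => A mA AD.
change ((leb \x leb) (A `&` D) = (leb \x leb) A).
by rewrite (setIidl AD).
Qed.

Lemma integral_ln (f : R -> \bar R) : measurable_fun [set: R] f ->
  \int[leb]_x f x = \int[leb]_(r in Rpos) (f (ln r) * (r^-1)%:E).
Proof.
move=> mf.
rewrite integralE [RHS]integralE; congr (_ - _).
  rewrite ge0_integral_ln//; last exact: measurable_funepos.
  apply: eq_integral => r; rewrite inE => r0.
  by rewrite !funeposE maxe_pMl ?lee_fin ?invr_ge0 1?ltW// mul0e.
rewrite ge0_integral_ln//; last exact: measurable_funeneg.
apply: eq_integral => r; rewrite inE => r0.
by rewrite !funenegE maxe_pMl ?lee_fin ?invr_ge0 1?ltW// mul0e mulNe.
Qed.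

Lemma measurable_Aff : measurable (@Aff R).
Proof.
rewrite -[Aff]setTI.
have mb : measurable_fun [set: R * R] (fun p : R * R => (0 < p.2)%R).
  exact: measurable_fun_ltr.
exact: (mb measurableT [set true]).
Qed.

(** The substitution a = e^w on every line of constant x; on Aff the weight 1
/ a is e^(- ln a), which is measurable on the whole plane. *)
Lemma ge0_integral_Aff (f : R * R -> \bar R) :
  measurable_fun [set: R * R] (fun p => f (p.1, expR p.2)) ->
  (forall p, Aff p -> 0 <= f p) ->
  \int[leb \x leb]_(p in Aff) (f p * (p.2^-1)%:E) =
  \int[leb \x leb]_p f (p.1, expR p.2).
Proof.
move=> mf f0.
have mln : measurable_fun [set: R * R] (fun p => f (p.1, expR (ln p.2))).
  apply: (measurableT_comp mf (f := fun p => f (p.1, expR p.2))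
    (g := fun p : R * R => (p.1, ln p.2))).
  by apply: measurable_fun_pair => //; exact: measurableT_comp.
have e : (fun p : R * R => f p * (p.2^-1)%:E) \_ Aff =
    (fun p => f (p.1, expR (ln p.2)) * (expR (- ln p.2))%:E * (\1_(Aff) p)%:E).
  apply/funext => -[x a]; rewrite patchE indicE; case: ifPn => [|].
    rewrite inE/Aff/= => a0; rewrite mule1 lnK//.
    by rewrite expRN lnK.
  by rewrite mule0.
have nn p : 0 <= f (p.1, expR p.2) by apply: f0; rewrite /Aff/= expR_gt0.
have mA := measurable_Aff.
rewrite integral_mkcond e fubini_tonelli1; last 2 first.
- apply: emeasurable_funM; [apply: emeasurable_funM => //|].
    apply/measurable_EFinP; apply: measurableT_comp => //.
    apply: measurable_funN; exact: measurableT_comp.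
  by apply/measurable_EFinP; exact: measurable_indic.
- move=> p; rewrite mule_ge0 ?lee_fin// mule_ge0 ?lee_fin ?expR_ge0//.
  exact: (nn (p.1, ln p.2)).
rewrite fubini_tonelli1//.
apply: eq_integral => x _; rewrite /fubini_F/=.
rewrite (ge0_integral_ln (f := fun w => f (x, expR w)))//; last 2 first.
- apply: (measurableT_comp mf (g := pair x)) => //.
- by move=> w; exact: (nn (x, w)).
rewrite [RHS]integral_mkcond; apply: eq_integral => a _.
rewrite patchE indicE; case: ifPn => [|].
  rewrite inE/Rpos/= => a0; rewrite mem_set ?mule1//.
  by rewrite expRN lnK.
move=> h; rewrite memNset ?mule0//.
by move: h; rewrite notin_setE.
Qed.

Lemma integral_Aff (f : R * R -> R) :
  measurable_fun [set: R * R] (fun p => f (p.1, expR p.2)) ->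
  \int[leb \x leb]_(p in Aff) (f p * p.2^-1)%:E =
  \int[leb \x leb]_p (f (p.1, expR p.2))%:E.
Proof.
move=> mf; have mf' := (measurable_EFinP _ _).2 mf.
rewrite integralE [RHS]integralE; congr (_ - _).
  transitivity (\int[leb \x leb]_(p in Aff) ((EFin \o f)^\+ p * (p.2^-1)%:E)).
    apply: eq_integral => p; rewrite inE/Aff/= => p0.
    by rewrite !funeposE/= EFinM maxe_pMl ?lee_fin ?invr_ge0 1?ltW// mul0e.
  rewrite ge0_integral_Aff//.
    by apply: eq_integral => p _; rewrite !funeposE.
  have := measurable_funepos mf'; congr (measurable_fun _ _).
  by apply/funext => p; rewrite !funeposE.
transitivity (\int[leb \x leb]_(p in Aff) ((EFin \o f)^\- p * (p.2^-1)%:E)).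
  apply: eq_integral => p; rewrite inE/Aff/= => p0.
  rewrite !funenegE -[X in maxe (- X) _]/((f p)%:E * (p.2^-1)%:E).
  by rewrite -mulNe maxe_pMl ?lee_fin ?invr_ge0 1?ltW// mul0e.
rewrite ge0_integral_Aff//.
  by apply: eq_integral => p _; rewrite !funenegE.
have := measurable_funeneg mf'; congr (measurable_fun _ _).
by apply/funext => p; rewrite !funenegE.
Qed.

End ChangeOfVariables.

(** * Integrals of real-valued functions *)

Section Toolkit.
Context d (T : measurableType d) (R : realType).
Variable mu : {measure set T -> \bar R}.
Implicit Types f g h : T -> R.
Local Notation intg f := (mu.-integrable setT (EFin \o f)).

Lemma integrable_measurable f : intg f -> measurable_fun setT f.
Proof. by move=> /measurable_int/measurable_EFinP. Qed.

Lemma integrable_le f g : measurable_fun setT f ->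
  (forall x, `|f x| <= g x) -> intg g -> intg f.
Proof.
move=> mf fg; apply: le_integrable => //; first exact/measurable_EFinP.
by move=> x _; rewrite /= lee_fin (le_trans (fg x)) ?ler_norm.
Qed.

Lemma integrable_add f g : intg f -> intg g -> intg (fun x => f x + g x).
Proof. by move=> hf hg; have := integrableD measurableT hf hg. Qed.

Lemma integrable_opp f : intg f -> intg (fun x => - f x).
Proof. by move=> hf; have := integrableN hf. Qed.

Lemma integrable_sub f g : intg f -> intg g -> intg (fun x => f x - g x).
Proof. by move=> hf hg; apply: integrable_add => //; exact: integrable_opp. Qed.

Lemma integrable_scale c f : intg f -> intg (fun x => c * f x).
Proof. by move=> hf; have := integrableZl measurableT c hf. Qed.

Lemma integrable_mul_bounded f g (M : R) : measurable_fun setT g ->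
  (forall x, `|g x| <= M) -> intg f -> intg (fun x => f x * g x).
Proof.
move=> mg gM hf.
apply: (@integrable_le _ (fun x => M * `|f x|)).
- apply: measurable_funM => //; exact: integrable_measurable.
- by move=> x; rewrite normrM mulrC ler_wpM2r.
- by apply: integrable_scale; exact: integrable_norm.
Qed.

(** If both parts of f have infinite integral, [fine] sends both sides to 0.
*)
Lemma RintegralN f :
  \int[mu]_x (- f x) = - \int[mu]_x f x.
Proof.
rewrite /Rintegral [in LHS]integralE [in RHS]integralE.
have -> : (\int[mu]_x (fun x => (- f x)%:E)^\+ x =
           \int[mu]_x (fun x => (f x)%:E)^\- x)%E.
  by apply: eq_integral => x _; rewrite funeposE funenegE.
have -> : (\int[mu]_x (fun x => (- f x)%:E)^\- x =
           \int[mu]_x (fun x => (f x)%:E)^\+ x)%E.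
  by apply: eq_integral => x _; rewrite funeposE funenegE -EFinN opprK.
set a := integral _ _ _; set b := integral _ _ _.
by case: a b => [a| |] [b| |] //=; rewrite ?oppr0// opprB.
Qed.

Lemma EFin_Rintegral f : intg f ->
  (\int[mu]_x f x)%:E = (\int[mu]_x (f x)%:E)%E.
Proof. by move=> If; rewrite fineK// integrable_fin_num. Qed.

Lemma normr_Rintegral_le f g : intg g -> measurable_fun setT f ->
  (forall x, `|f x| <= g x) -> `|\int[mu]_x f x| <= \int[mu]_x g x.
Proof.
move=> ig mf fg; have If := integrable_le mf fg ig.
apply: (le_trans (le_normr_Rintegral measurableT If)).
by apply: le_Rintegral => //; exact: integrable_norm.
Qed.

Lemma Rintegral_dominated_cvg (f_ : nat -> T -> R) f g :
  (forall n, measurable_fun setT (f_ n)) -> measurable_fun setT f ->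
  (forall x, f_ n x @[n --> \oo] --> f x) ->
  (forall n x, `|f_ n x| <= g x) -> intg g ->
  (\int[mu]_x f_ n x) @[n --> \oo] --> \int[mu]_x f x.
Proof.
move=> mf_ mf cf fg ig.
have [If _ H] : [/\ intg f,
    [sequence \int[mu]_x `|(f_ n x)%:E - (f x)%:E|]_n @ \oo --> 0 &
    [sequence \int[mu]_x (f_ n x)%:E]_n @ \oo --> \int[mu]_x (f x)%:E]%E.
  apply: (@dominated_convergence _ _ _ mu _ measurableT
    (fun n => EFin \o f_ n) (EFin \o f) (EFin \o g)) => //.
  - by move=> n; exact/measurable_EFinP.
  - exact/measurable_EFinP.
  - by apply: aeW => x _; apply: cvg_EFin; [exact: nearW|exact: cf].
  - by apply: aeW => x n _; rewrite /= lee_fin.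
by apply: fine_cvg; rewrite EFin_Rintegral.
Qed.

End Toolkit.

(** * Fubini's theorem and measurability in the plane *)

Section Measurability.
Context {R : realType}.
Local Notation leb := (@lebesgue_measure R).

Lemma measurable_Rintegral d (T : measurableType d) (F : T * R -> R) :
  measurable_fun setT F ->
  measurable_fun setT (fun x => \int[leb]_u F (x, u)).
Proof.
move=> mF; have mF' := (measurable_EFinP _ _).2 mF.
apply: (measurableT_comp (f := fine)); first exact: fine_measurable.
rewrite (_ : (fun x => _) = (fun x => \int[leb]_u ((EFin \o F)^\+ (x, u))
  - \int[leb]_u ((EFin \o F)^\- (x, u)))%E).
  apply: emeasurable_funB.
    exact: (@measurable_fun_fubini_tonelli_F _ _ T _ R leb ((EFin \o F)^\+)%E
    (measurable_funepos mF') (fun=> funepos_ge0 _ _)).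
  exact: (@measurable_fun_fubini_tonelli_F _ _ T _ R leb ((EFin \o F)^\-)%E
    (measurable_funeneg mF') (fun=> funeneg_ge0 _ _)).
apply/funext => x; rewrite integralE; congr (_ - _)%E;
  by apply: eq_integral => u _; rewrite ?funeposE ?funenegE.
Qed.

(** An open set of the plane is a union of squares with rational centres and
radii 1 / (n + 1), and there are countably many of those. *)
Lemma open_measurable2 (U : set (R * R)) : open U -> measurable U.
Proof.
move=> oU.
pose B (a b : rat) (n : nat) : set (R * R) :=
  ball (ratr a : R) n.+1%:R^-1 `*` ball (ratr b : R) n.+1%:R^-1.
pose C a b n : set (R * R) := if `[< B a b n `<=` U >] then B a b n else set0.
have -> : U = \bigcup_a \bigcup_b \bigcup_n C a b n.
  apply/seteqP; split => [[x y] Uxy|p [a _ [b _ [n _]]]]; last first.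
    by rewrite /C; case: asboolP => // BU; exact: BU.
  have /nbhs_ballP[e /= e0 eU] : nbhs (x, y) U by exact: open_nbhs_nbhs.
  (* half of e, because the centre of the square may be off by its radius *)
  have [n ne] : exists n : nat, n.+1%:R^-1 < e / 2.
    have [n] := ltr_add_invr (divr_gt0 e0 (ltr0Sn R 1)).
    by rewrite add0r => ?; exists n.
  have r0 : 0 < n.+1%:R^-1 :> R by rewrite invr_gt0.
  have close z : exists a : rat, `|ratr a - z| < n.+1%:R^-1 :> R.
    have [|a aI] := @rat_in_itvoo R (z - n.+1%:R^-1) (z + n.+1%:R^-1).
      by rewrite ltrD2l gtrN.
    by exists a; rewrite ltr_distl; move: aI; rewrite in_itv/=.
  have [a ax] := close x; have [b by_] := close y.
  have Cxy : C a b n = B a b n.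
    rewrite /C; case: asboolP => // -[]; move=> [x' y'] [/= h1 h2].
    apply: eU; split => /=.
      rewrite /ball/= in h1 *; rewrite -(subrKA (ratr a)).
      rewrite (le_lt_trans (ler_normD _ _))// (distrC x) (splitr e).
      by apply: ltrD; [exact: lt_trans ax ne|exact: lt_trans h1 ne].
    rewrite /ball/= in h2 *; rewrite -(subrKA (ratr b)).
    rewrite (le_lt_trans (ler_normD _ _))// (distrC y) (splitr e).
    by apply: ltrD; [exact: lt_trans by_ ne|exact: lt_trans h2 ne].
  by exists a => //; exists b => //; exists n => //; rewrite Cxy.
apply: bigcupT_measurable_rat => a; apply: bigcupT_measurable_rat => b.
apply: bigcupT_measurable => n; rewrite /C; case: ifPn => // _.
by apply: measurableX; exact: measurable_ball.
Qed.

Lemma continuous_measurable_fun2 (f : R * R -> R) :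
  continuous f -> measurable_fun setT f.
Proof.
move=> /continuousP cf; apply: (measurability _ (RGenOpens.measurableE R)).
move=> _ [_ [a [b ->] <-]]; rewrite setTI; apply: open_measurable2.
exact/cf/interval_open.
Qed.

Lemma integrable_prodM (p q : R -> R) :
  leb.-integrable setT (EFin \o p) -> leb.-integrable setT (EFin \o q) ->
  (leb \x leb)%E.-integrable setT (EFin \o (fun z => p z.1 * q z.2)).
Proof.
move=> ip iq.
have mp := integrable_measurable ip; have mq := integrable_measurable iq.
apply/integrable12ltyP.
  by apply/measurable_EFinP; apply: measurable_funM; exact: measurableT_comp.
have -> : (\int[leb]_x \int[leb]_y `|(EFin \o (fun z => p z.1 * q z.2)%R) (x, y)|
    = (\int[leb]_x `|p x|%:E) * (\int[leb]_y `|q y|%:E))%E.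
  rewrite -ge0_integralZr//; last 2 first.
  - by apply/measurable_EFinP; exact: measurableT_comp.
  - exact: integral_ge0.
  apply: eq_integral => x _.
  rewrite -ge0_integralZl//; last first.
    by apply/measurable_EFinP; exact: measurableT_comp.
  by apply: eq_integral => y _ /=; rewrite normrM EFinM.
have /integrableP[_ hp] := ip; have /integrableP[_ hq] := iq.
by apply: lte_mul_pinfty => //; [exact: integral_ge0|rewrite ge0_fin_numE// integral_ge0].
Qed.

(** Integrability of every slice, and not just of almost every one, allows the
inner integral to be taken in R. *)
Lemma Rintegral12 (F : R * R -> R) :
  (leb \x leb)%E.-integrable setT (EFin \o F) ->
  (forall x, leb.-integrable setT (EFin \o (fun u => F (x, u)))) ->
  \int[(leb \x leb)%E]_z F z = \int[leb]_x \int[leb]_u F (x, u).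
Proof.
move=> iF iFx; rewrite /Rintegral -(integral12_prod_meas1 iF); congr fine.
by apply: eq_integral => x _; apply/esym; exact: (EFin_Rintegral (iFx x)).
Qed.

Lemma Rintegral21 (F : R * R -> R) :
  (leb \x leb)%E.-integrable setT (EFin \o F) ->
  (forall u, leb.-integrable setT (EFin \o (fun x => F (x, u)))) ->
  \int[(leb \x leb)%E]_z F z = \int[leb]_u \int[leb]_x F (x, u).
Proof.
move=> iF iFx; rewrite /Rintegral -(integral21_prod_meas1 iF); congr fine.
by apply: eq_integral => u _; apply/esym; exact: (EFin_Rintegral (iFx u)).
Qed.

Lemma Rintegral_swap (p q : R -> R) (c : R * R -> R) (M : R) :
  leb.-integrable setT (EFin \o p) -> leb.-integrable setT (EFin \o q) ->
  measurable_fun setT c -> (forall z, `|c z| <= M) ->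
  \int[leb]_x (p x * \int[leb]_u (q u * c (x, u))) =
  \int[leb]_u (q u * \int[leb]_x (p x * c (x, u))).
Proof.
move=> ip iq mc cM.
have mp := integrable_measurable ip; have mq := integrable_measurable iq.
have iF : (leb \x leb)%E.-integrable setT
    (EFin \o (fun z => p z.1 * q z.2 * c z)).
  by apply: integrable_mul_bounded => //; exact: integrable_prodM.
have iqc x : leb.-integrable setT (EFin \o (fun u => q u * c (x, u))).
  apply: integrable_mul_bounded => //; exact: measurable_fun_pair2.
have ipc u : leb.-integrable setT (EFin \o (fun x => p x * c (x, u))).
  apply: integrable_mul_bounded => //; exact: measurable_fun_pair1.
transitivity (\int[(leb \x leb)%E]_z (p z.1 * q z.2 * c z)).
  rewrite Rintegral12//; last first.
    move=> x; have := integrable_scale (p x) (iqc x).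
    by congr (integrable _ _ _); apply/funext => u /=; rewrite mulrA.
  apply: eq_Rintegral => x _; rewrite -RintegralZl//.
  by apply: eq_Rintegral => u _ /=; rewrite mulrA.
rewrite Rintegral21//; last first.
  move=> u; have := integrable_scale (q u) (ipc u).
  by congr (integrable _ _ _); apply/funext => x /=; rewrite mulrCA mulrA.
apply: eq_Rintegral => u _; rewrite -RintegralZl//.
by apply: eq_Rintegral => x _ /=; rewrite mulrCA mulrA.
Qed.

Lemma Rintegral_shift (c : R) (f : R -> R) : measurable_fun setT f ->
  \int[leb]_x f (x + c) = \int[leb]_x f x.
Proof.
move=> mf; congr fine; apply: (integral_shift c (f := EFin \o f)).
exact/measurable_EFinP.
Qed.

Lemma Rintegral_oppr (f : R -> R) : measurable_fun setT f ->
  \int[leb]_x f (- x) = \int[leb]_x f x.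
Proof.
move=> mf; congr fine; apply: (integral_oppr (f := EFin \o f)).
exact/measurable_EFinP.
Qed.

Lemma Rintegral_affine (e c : R) (f : R -> R) : 0 < e ->
  leb.-integrable setT (EFin \o f) ->
  \int[leb]_x f (e * x + c) = e^-1 * \int[leb]_x f x.
Proof.
move=> e0 If; have mf := (measurable_EFinP _ _).2 (integrable_measurable If).
rewrite /Rintegral [in LHS]integralE [in RHS]integralE.
have H (g : R -> \bar R) : measurable_fun setT g -> (forall x, 0 <= g x)%E ->
  (\int[leb]_x g (e * x + c)%R = (e^-1)%:E * \int[leb]_x g x)%E.
  exact: ge0_integral_affine.
have -> : (\int[leb]_x (fun x => (f (e * x + c))%:E)^\+ x =
   (e^-1)%:E * \int[leb]_x (EFin \o f)^\+ x)%E.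
  rewrite -H//; last exact: measurable_funepos.
  by apply: eq_integral => x _; rewrite !funeposE.
have -> : (\int[leb]_x (fun x => (f (e * x + c))%:E)^\- x =
   (e^-1)%:E * \int[leb]_x (EFin \o f)^\- x)%E.
  rewrite -H//; last exact: measurable_funeneg.
  by apply: eq_integral => x _; rewrite !funenegE.
have hp := integrable_pos_fin_num measurableT If.
have hn := integrable_neg_fin_num measurableT If.
by rewrite -muleBr ?fin_num_adde_defr// fineM// fin_numB hp hn.
Qed.

End Measurability.

(** * Plancherel's identity on the line *)

Section Kernels.
Context {R : realType}.
Local Notation leb := (@lebesgue_measure R).
Local Notation intg f := (leb.-integrable setT (EFin \o f)).

(** The common majorant in what follows; pi^-1 times it is the Poisson kernel
at height 1. *)
Definition lorentz (s : R) : R := (1 + s ^+ 2)^-1.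

Lemma lorentz_gt0 s : 0 < lorentz s.
Proof. by rewrite invr_gt0 ltr_pwDl// sqr_ge0. Qed.

Lemma lorentz_ge0 s : 0 <= lorentz s.
Proof. exact/ltW/lorentz_gt0. Qed.

Lemma lorentz_le1 s : lorentz s <= 1.
Proof. by rewrite invf_le1 ?lerDl ?sqr_ge0// ltr_pwDl// sqr_ge0. Qed.

Lemma continuous_lorentz : continuous lorentz.
Proof.
move=> s; apply: cvgV; first by rewrite gt_eqF// ltr_pwDl// sqr_ge0.
by apply: cvgD; [exact: cvg_cst|exact: exprn_continuous].
Qed.

Lemma integral_lorentz : (\int[leb]_s (lorentz s)%:E = pi%:E)%E.
Proof.
rewrite ge0_symfun_integralT; last 3 first.
- by move=> x; exact/ltW/lorentz_gt0.
- exact: continuous_lorentz.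
- by move=> x; rewrite /lorentz/= sqrrN.
rewrite -set_itvcy (@ge0_continuous_FTC2y _ _ (@atan R) _ (pi / 2)).
- by rewrite atan0 sube0 -EFinM mulrC divfK.
- by move=> x _; exact/ltW/lorentz_gt0.
- by apply: continuous_subspaceT; exact: continuous_lorentz.
- exact: cvgy_atan.
- by move=> x _; exact: derivable_atan.
- by apply: cvg_at_right_filter; exact: continuous_atan.
- by move=> x _; rewrite derive1_atan.
Qed.

Lemma integrable_lorentz : intg lorentz.
Proof.
apply/integrableP; split.
  apply/measurable_EFinP; apply: continuous_measurable_fun.
  exact: continuous_lorentz.
under eq_integral do rewrite /= ger0_norm ?(ltW (lorentz_gt0 _))//.
by rewrite integral_lorentz ltry.
Qed.

Lemma Rintegral_lorentz : \int[leb]_s lorentz s = pi.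
Proof. by rewrite /Rintegral integral_lorentz. Qed.

Definition damp (c x : R) : R := expR (- (c * `|x|)).

Lemma damp_ge0 c x : 0 <= damp c x. Proof. exact: expR_ge0. Qed.

Lemma continuous_damp c : continuous (damp c).
Proof.
move=> x; apply: continuous_comp; last exact: continuous_expR.
apply: cvgN; apply: cvgM; first exact: cvg_cst.
exact: norm_continuous.
Qed.

Lemma is_derive_scale (f : R -> R) (k x df : R) :
  is_derive (k * x) 1 f df -> is_derive x 1 (fun y => f (k * y)) (k * df).
Proof.
move=> hf.
have hk : is_derive x 1 (fun y : R => k * y) k.
  have := is_deriveZ k (is_derive_id x (1 : R)).
  by rewrite /GRing.scale/= mulr1.
by rewrite mulrC; exact: (@is_derive1_comp _ f (fun y => k * y)).
Qed.

(** Adding 1 to the cosine makes the integrand nonnegative, so the integral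
over a half-line is read off from the antiderivative F at the endpoints. *)
Lemma integral_damp_1cos (b c : R) : 0 < c ->
  (\int[leb]_x (damp c x * (1 + cos (b * x)))%:E =
   (2 * (c^-1 + c / (c ^+ 2 + b ^+ 2)))%:E)%E.
Proof.
move=> c0.
have d0 : 0 < c ^+ 2 + b ^+ 2 by rewrite ltr_pwDl ?sqr_ge0 ?exprn_gt0.
have cc x : {for x, continuous (fun y : R => cos (b * y))}.
  apply: continuous_comp; last exact: continuous_cos.
  by apply: cvgM; [exact: cvg_cst|exact: cvg_id].
have cf : continuous (fun x => damp c x * (1 + cos (b * x))).
  move=> x; apply: cvgM; first exact: continuous_damp.
  by apply: cvgD; [exact: cvg_cst|exact: cc].
have f0 x : 0 <= damp c x * (1 + cos (b * x)).
  by rewrite mulr_ge0 ?damp_ge0.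
rewrite ge0_symfun_integralT//; last first.
  by move=> x /=; rewrite /damp normrN mulrN cosN.
pose F x : R := expR (- (c * x)) *
  (- c^-1 + (b * sin (b * x) - c * cos (b * x)) / (c ^+ 2 + b ^+ 2)).
have dF (x : R) : is_derive x 1 F (expR (- (c * x)) * (1 + cos (b * x))).
  have de : is_derive x 1 (fun y => expR (- c * y)) (- c * expR (- c * x)).
    exact: is_derive_scale.
  have dc : is_derive x 1 (fun y => cos (b * y)) (b * - sin (b * x)).
    exact: is_derive_scale.
  have ds : is_derive x 1 (fun y => sin (b * y)) (b * cos (b * x)).
    exact: is_derive_scale.
  have dG := is_deriveM de (is_deriveD (is_derive_cst (- c^-1) x 1)
    (is_deriveZ (c ^+ 2 + b ^+ 2)^-1 (is_deriveB (is_deriveZ b ds) (is_deriveZ c dc)))).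
  have -> : F = (fun y => expR (- c * y)) * (cst (- c^-1) + (c ^+ 2 + b ^+ 2)^-1 \*:
     (b \*: (fun y => sin (b * y)) - c \*: (fun y => cos (b * y)))).
    by apply/funext => y; rewrite /F -mulNr [X in _ * (_ + X)]mulrC.
  apply: is_derive_eq => /=.
  rewrite /GRing.scale/= mulNr.
  rewrite [X in _ + X * _](_ : _ = - c^-1 +
    (c ^+ 2 + b ^+ 2)^-1 * (b * sin (b * x) - c * cos (b * x)))//.
  by field; rewrite !gt_eqF.

rewrite -set_itvcy (@ge0_continuous_FTC2y _ _ F _ 0).
- rewrite /F mulr0 oppr0 expR0 mulr0 cos0 sin0 sub0e -EFinN -EFinM; congr EFin.
  by rewrite mul1r mulr0 sub0r mulr1 mulNr opprD !opprK.
- by move=> x _; exact: f0.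
- exact: continuous_subspaceT.
- have -> : F = (fun x => expR (- (c * x)) *
      (- c^-1 + (b * sin (b * x) - c * cos (b * x)) / (c ^+ 2 + b ^+ 2))) by [].
  have e0 : expR (- (c * x)) @[x --> +oo] --> 0.
    apply: (@cvg_comp _ _ _ (fun x => c * x)
      (fun y => expR (- y)) _ +oo _ _ (@cvgr_expR R)).
    exact: gt0_cvgMry.
  pose M := c^-1 + (`|b| + c) / (c ^+ 2 + b ^+ 2).
  apply/norm_cvg0P; apply: (@squeeze_cvgr _ _ _ _ (cst 0) (fun x => expR (- (c * x)) * M)).
  + apply: nearW => x /=; rewrite normr_ge0/= normrM ger0_norm ?expR_ge0//.
    rewrite ler_wpM2l ?expR_ge0// (le_trans (ler_normD _ _))// normrN.
    rewrite /M (gtr0_norm (_ : 0 < c^-1)) ?invr_gt0// lerD2l normrM normfV.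
    rewrite (gtr0_norm d0) ler_wpM2r//; first by rewrite invr_ge0 ltW.
    rewrite (le_trans (ler_normB _ _))// !normrM (gtr0_norm c0) lerD//.
      by rewrite ler_piMr// sin_max.
    by rewrite ler_piMr ?(ltW c0)// cos_max.
  + exact: cvg_cst.
  + by rewrite -[X in _ --> X](mul0r M); apply: cvgMl.
- by move=> x _; have [] := dF x.
- apply: cvg_at_right_filter. apply: differentiable_continuous.
  by apply/derivable1_diffP; have [] := dF 0.
- move=> x; rewrite in_itv/= => /andP[x0 _].
  by rewrite derive1E /damp gtr0_norm//; have [_ ->] := dF x.
Qed.

Lemma integral_damp (c : R) : 0 < c ->
  (\int[leb]_x (damp c x)%:E = (2 * c^-1)%:E)%E.
Proof.
move=> c0; have := integral_damp_1cos 0 c0.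
under eq_integral do rewrite mul0r cos0 -mulr2n mulr_natr -[X in _ *+ X]/2%N -mulr_natl EFinM.
rewrite ge0_integralZl//; last 2 first.
- apply/measurable_EFinP; apply: continuous_measurable_fun.
  exact: continuous_damp.
- by move=> x _; rewrite lee_fin damp_ge0.
move=> /(congr1 (fun y => 2^-1%:E * y)%E).
rewrite muleA -EFinM mulVf ?mul1e// => ->; rewrite -EFinM; congr EFin.
by rewrite expr0n/= addr0; field; rewrite gt_eqF.
Qed.

Lemma integrable_damp (c : R) : 0 < c -> intg (damp c).
Proof.
move=> c0; apply/integrableP; split.
  apply/measurable_EFinP; apply: continuous_measurable_fun.
  exact: continuous_damp.
under eq_integral do rewrite /= ger0_norm ?damp_ge0//.
by rewrite integral_damp// ltry.
Qed.

Lemma continuous_trig (f : R -> R) (b : R) : continuous f ->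
  continuous (fun x => f (b * x)).
Proof.
move=> cf x; apply: continuous_comp; last exact: cf.
by apply: cvgM; [exact: cvg_cst|exact: cvg_id].
Qed.

(** The Fourier transform of the damping weight is a Poisson kernel. *)
Lemma Rintegral_damp_cos (b c : R) : 0 < c ->
  \int[leb]_x (damp c x * cos (b * x)) = 2 * (c / (c ^+ 2 + b ^+ 2)).
Proof.
move=> c0.
have Id := integrable_damp c0.
have Ic : intg (fun x => damp c x * cos (b * x)).
  apply: (integrable_mul_bounded (M := 1)) => //.
    by apply: continuous_measurable_fun; exact/continuous_trig/continuous_cos.
  by move=> x; exact: cos_max.
have : \int[leb]_x (damp c x + damp c x * cos (b * x)) =
    2 * (c^-1 + c / (c ^+ 2 + b ^+ 2)).
  rewrite /Rintegral -[RHS]/(fine (_)%:E) -(integral_damp_1cos b c0).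
  by congr fine; apply: eq_integral => x _; rewrite mulrDr mulr1.
rewrite RintegralD// {1}/Rintegral integral_damp//= mulrDr.
by move=> /addrI.
Qed.

(** With [sin_transform], the Fourier transform of a real k is cos_transform k
- i sin_transform k. *)
Definition cos_transform (k : R -> R) (x : R) : R :=
  \int[leb]_u (k u * cos (2 * pi * (x * u))).
Definition sin_transform (k : R -> R) (x : R) : R :=
  \int[leb]_u (k u * sin (2 * pi * (x * u))).

Section Plancherel1.
Variables (k : R -> R) (C : R).
Hypotheses (ck : continuous k) (kC : forall u, `|k u| <= C * lorentz u).

Let mk : measurable_fun setT k. Proof. exact: continuous_measurable_fun. Qed.
Let C0 : 0 <= C.
Proof. by have := le_trans (normr_ge0 _) (kC 0); rewrite pmulr_lge0// lorentz_gt0. Qed.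
Let kb u : `|k u| <= C.
Proof. by rewrite (le_trans (kC u))// ler_piMr// lorentz_le1. Qed.
Let Ik : intg k.
Proof.
apply: (@integrable_le _ _ _ leb _ (fun u => C * lorentz u)) => //.
by apply: integrable_scale; exact: integrable_lorentz.
Qed.

Let mtrig (f : R -> R) : continuous f ->
  measurable_fun setT (fun z : R * R => f (2 * pi * (z.1 * z.2))).
Proof.
move=> cf; apply: (measurableT_comp (continuous_measurable_fun cf)).
by apply: measurable_funM => //; exact: measurable_funM.
Qed.

(** What remains at frequency x of the product k(u) k(v) after the addition
formula: k(u) phase(x, u) integrates over u to the power spectrum at x. *)
Let phase (x u : R) : R := \int[leb]_v (k v * cos (2 * pi * (x * (u - v)))).

Let Icos (x : R) : intg (fun u => k u * cos (2 * pi * (x * u))).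
Proof.
apply: (integrable_mul_bounded (M := 1)) => //.
  exact: measurable_fun_pair2 (mtrig (@continuous_cos R)).
by move=> u; exact: cos_max.
Qed.

Let Isin (x : R) : intg (fun u => k u * sin (2 * pi * (x * u))).
Proof.
apply: (integrable_mul_bounded (M := 1)) => //.
  exact: measurable_fun_pair2 (mtrig (@continuous_sin R)).
by move=> u; exact: sin_max.
Qed.

Let phaseE x u : phase x u =
  cos_transform k x * cos (2 * pi * (x * u)) + sin_transform k x * sin (2 * pi * (x * u)).
Proof.
rewrite /cos_transform /sin_transform -!RintegralZr// -RintegralD//; last 2 first.
- by under eq_fun do rewrite mulrC; apply: integrable_scale; exact: Icos.
- by under eq_fun do rewrite mulrC; apply: integrable_scale; exact: Isin.
apply: eq_Rintegral => v _; rewrite !mulrBr cosB; ring.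
Qed.

Let powerE x : cos_transform k x ^+ 2 + sin_transform k x ^+ 2 =
  \int[leb]_u (k u * phase x u).
Proof.
under eq_Rintegral do rewrite phaseE.
transitivity (\int[leb]_u (cos_transform k x * (k u * cos (2 * pi * (x * u))) +
    sin_transform k x * (k u * sin (2 * pi * (x * u))))); last first.
  by apply: eq_Rintegral => u _; ring.
rewrite RintegralD//; [|exact: integrable_scale|exact: integrable_scale].
by rewrite !RintegralZl// !expr2.
Qed.

Let mphase : measurable_fun setT (fun z : R * R => phase z.1 z.2).
Proof.
apply: (measurable_Rintegral (F := fun z : (R * R) * R =>
  k z.2 * cos (2 * pi * (z.1.1 * (z.1.2 - z.2))))).
apply: measurable_funM; first exact: measurableT_comp.
apply: (measurableT_comp (continuous_measurable_fun (@continuous_cos R))).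
apply: measurable_funM => //; apply: measurable_funM => //.
  exact: measurableT_comp.
by apply: measurable_funB => //; exact: measurableT_comp.
Qed.

Let phase_le z : `|phase z.1 z.2| <= \int[leb]_v `|k v|.
Proof.
apply: normr_Rintegral_le; first exact: integrable_norm.
  apply: measurable_funM => //.
  apply: (measurableT_comp (continuous_measurable_fun (@continuous_cos R))).
  by apply: measurable_funM => //; apply: measurable_funM => //; exact: measurable_funB.
by move=> v; rewrite normrM ler_piMr// cos_max.
Qed.

(** Integrating over x first replaces the phase by the Poisson kernel P at u -
v; the substitution v = e s + u then moves the small parameter from the kernel
into the argument of k. *)
Let damped e : 0 < e ->
  \int[leb]_x (damp (2 * pi * e) x * (cos_transform k x ^+ 2 + sin_transform k x ^+ 2)) =
  \int[leb]_u (k u * \int[leb]_s (k (e * s + u) * (pi^-1 * lorentz s))).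
Proof.
move=> e0.
have pi0 := pi_gt0 R.
have c0 : 0 < 2 * pi * e by rewrite !mulr_gt0.
under eq_Rintegral do rewrite powerE.
rewrite (Rintegral_swap (c := fun z => phase z.1 z.2) (integrable_damp c0)
  Ik mphase phase_le).
apply: eq_Rintegral => u _; congr (_ * _).
rewrite /phase
  (Rintegral_swap (c := fun z => cos (2 * pi * (z.1 * (u - z.2)))) (M := 1)
    (integrable_damp c0) Ik); last 2 first.
- apply: (measurableT_comp (continuous_measurable_fun (@continuous_cos R))).
  by apply: measurable_funM => //; apply: measurable_funM => //; exact: measurable_funB.
- by move=> z; exact: cos_max.
(* the value at t of the Fourier transform of the damping weight *)
pose P t := 2 * (2 * pi * e / ((2 * pi * e) ^+ 2 + (2 * pi * t) ^+ 2)).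
transitivity (\int[leb]_v (k v * P (u - v))).
  apply: eq_Rintegral => v _; congr (_ * _); rewrite /P -Rintegral_damp_cos//.
  by apply: eq_Rintegral => x _; congr (_ * cos _) => /=; ring.
have PE t : P t = (e * pi)^-1 * lorentz (t / e).
  rewrite /P /lorentz; move: (pi : R) pi0 => q q0; field.
  by rewrite !gt_eqF//= ?ltr_pwDl ?sqr_ge0 ?exprn_gt0 ?mulr_gt0.
have P0 t : 0 <= P t.
  rewrite PE; apply: mulr_ge0; last exact: lorentz_ge0.
  by rewrite invr_ge0; apply: mulr_ge0; exact: ltW.
have mP : measurable_fun setT (fun v : R => P ((u : R) - v)).
  rewrite (_ : (fun v => _) = (fun v : R => (e * pi)^-1 * lorentz (((u : R) - v) / e))).
    apply: measurable_funM => //.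
    apply: (measurableT_comp (continuous_measurable_fun continuous_lorentz)).
    by apply: measurable_funM => //; exact: measurable_funB.
  by apply/funext => v; rewrite PE.
have IP : intg (fun v => k v * P (u - v)).
  apply: (integrable_mul_bounded (M := (e * pi)^-1)) => // v.
  by rewrite ger0_norm// PE ler_piMr ?lorentz_le1// invr_ge0 mulr_ge0 ?ltW.
have -> : \int[leb]_v (k v * P (u - v)) =
    e * \int[leb]_s (k (e * s + u) * P (u - (e * s + u))).
  by rewrite (Rintegral_affine u e0 IP) mulrA mulfV ?mul1r// gt_eqF.
have PE' s : P (u - (e * s + u)) = (e * pi)^-1 * lorentz s.
  rewrite PE /lorentz; congr (_ * (1 + _)^-1); rewrite opprD addrCA subrr addr0.
  by rewrite mulNr sqrrN mulrAC mulfV ?mul1r// gt_eqF.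
rewrite -RintegralZl//; last first.
  under eq_fun do rewrite PE'.
  rewrite (_ : EFin \o _ =
    EFin \o (fun s : R => (e * pi)^-1 * lorentz s * k (e * s + u))); last first.
    by apply/funext => s /=; rewrite mulrC.
  apply: (integrable_mul_bounded (M := C)) => //.
    by apply: (measurableT_comp mk); exact: measurable_funD.
  by apply: integrable_scale; exact: integrable_lorentz.
apply: eq_Rintegral => s _; rewrite PE' invfM.
by rewrite mulrCA !mulrA mulfK// gt_eqF.
Qed.

Let pc0 s : 0 <= pi^-1 * lorentz s.
Proof.
by apply: mulr_ge0; [rewrite invr_ge0 pi_ge0|exact: lorentz_ge0].
Qed.

(** The Poisson kernel is an approximate identity. *)
Let smooth_limit (u : R) :
  \int[leb]_s (k (n.+1%:R^-1 * s + u) * (pi^-1 * lorentz s)) @[n --> \oo] --> k u.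
Proof.
have pi0 := pi_gt0 R.
rewrite [X in _ --> X](_ : k u = \int[leb]_s (k u * (pi^-1 * lorentz s))); last first.
  rewrite !RintegralZl//; last 2 first.
  - exact: integrable_lorentz.
  - by apply: integrable_scale; exact: integrable_lorentz.
  by rewrite Rintegral_lorentz mulVf ?mulr1// gt_eqF.
have mc : measurable_fun setT (fun s : R => pi^-1 * lorentz s).
  apply: measurable_funM => //; apply: continuous_measurable_fun.
  exact: continuous_lorentz.
apply: (@Rintegral_dominated_cvg _ _ _ leb _ _ (fun s => C * (pi^-1 * lorentz s))).
- move=> n; apply: measurable_funM => //; apply: (measurableT_comp mk).
  by apply: measurable_funD => //; exact: measurable_funM.
- exact: measurable_funM.
- move=> s; apply: cvgMl.
  apply: continuous_cvg; first exact: ck.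
  rewrite -[X in _ --> X](add0r u) -[X in _ --> X + _](mul0r s).
  apply: cvgD; last exact: cvg_cst.
  by apply: cvgMl; exact: cvg_harmonic.
- by move=> n s; rewrite normrM (ger0_norm (pc0 s)) ler_wpM2r.
- by do 2 apply: integrable_scale; exact: integrable_lorentz.
Qed.

Let smooth_le (e u : R) :
  `|\int[leb]_s (k (e * s + u) * (pi^-1 * lorentz s))| <= C.
Proof.
have pi0 := pi_gt0 R.
apply: (@le_trans _ _ (\int[leb]_s (C * (pi^-1 * lorentz s)))).
  apply: normr_Rintegral_le.
  - by do 2 apply: integrable_scale; exact: integrable_lorentz.
  - apply: measurable_funM.
      apply: (measurableT_comp mk).
      by apply: measurable_funD => //; exact: measurable_funM.
    apply: measurable_funM => //; apply: continuous_measurable_fun.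
    exact: continuous_lorentz.
  - by move=> s; rewrite normrM (ger0_norm (pc0 s)) ler_wpM2r.
rewrite !RintegralZl//; last 2 first.
- exact: integrable_lorentz.
- by apply: integrable_scale; exact: integrable_lorentz.
by rewrite Rintegral_lorentz mulVf ?mulr1// gt_eqF.
Qed.

Let mcos : measurable_fun setT (cos_transform k).
Proof.
apply: (measurable_Rintegral (F := fun z : R * R => k z.2 * cos (2 * pi * (z.1 * z.2)))).
apply: measurable_funM; first exact: measurableT_comp.
exact: mtrig (@continuous_cos R).
Qed.

Let msin : measurable_fun setT (sin_transform k).
Proof.
apply: (measurable_Rintegral (F := fun z : R * R => k z.2 * sin (2 * pi * (z.1 * z.2)))).
apply: measurable_funM; first exact: measurableT_comp.
exact: mtrig (@continuous_sin R).
Qed.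

Let power_le x : `|cos_transform k x ^+ 2 + sin_transform k x ^+ 2| <=
  (\int[leb]_u `|k u|) ^+ 2 + (\int[leb]_u `|k u|) ^+ 2.
Proof.
have S0 : 0 <= \int[leb]_u `|k u| by apply: Rintegral_ge0.
have hc : `|cos_transform k x| <= \int[leb]_u `|k u|.
  apply: normr_Rintegral_le; first exact: integrable_norm.
    exact: integrable_measurable (Icos x).
  by move=> u; rewrite normrM ler_piMr// cos_max.
have hs : `|sin_transform k x| <= \int[leb]_u `|k u|.
  apply: normr_Rintegral_le; first exact: integrable_norm.
    exact: integrable_measurable (Isin x).
  by move=> u; rewrite normrM ler_piMr// sin_max.
rewrite ger0_norm ?addr_ge0 ?sqr_ge0//.
rewrite -(real_normK (num_real (cos_transform k x))).
rewrite -(real_normK (num_real (sin_transform k x))).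
by rewrite lerD// lerXn2r.
Qed.

(** As e decreases to 0 the left-hand side of [damped] increases to the
integral of the power spectrum, while its right-hand side tends to the
integral of k^2. *)
Lemma plancherel1 :
  (\int[leb]_x (cos_transform k x ^+ 2 + sin_transform k x ^+ 2)%:E =
   \int[leb]_u (k u ^+ 2)%:E)%E.
Proof.
have pi0 := pi_gt0 R.
set N := fun x => cos_transform k x ^+ 2 + sin_transform k x ^+ 2.
have mN : measurable_fun setT N by apply: measurable_funD; exact: measurable_funX.
have N0 x : 0 <= N x by rewrite addr_ge0 ?sqr_ge0.
pose c n : R := 2 * pi * n.+1%:R^-1.
have c0 n : 0 < c n by rewrite !mulr_gt0 ?invr_gt0.
have IN n : intg (fun x => damp (c n) x * N x).
  by apply: (@integrable_mul_bounded _ _ _ leb _ _ _ mN power_le); exact: integrable_damp.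
pose I n u := \int[leb]_s (k (n.+1%:R^-1 * s + u) * (pi^-1 * lorentz s)).
have mI n : measurable_fun setT (I n).
  apply: (measurable_Rintegral (F := fun z : R * R =>
     k (n.+1%:R^-1 * z.2 + z.1) * (pi^-1 * lorentz z.2))).
  apply: measurable_funM.
    apply: (measurableT_comp mk); apply: measurable_funD => //.
    exact: measurable_funM.
  apply: measurable_funM => //; apply: measurableT_comp => //.
  by apply: continuous_measurable_fun; exact: continuous_lorentz.
have lim1 : (\int[leb]_x (damp (c n) x * N x)%:E)%E @[n --> \oo] -->
    (\int[leb]_u (k u ^+ 2))%:E.
  rewrite (_ : (fun n => _) = (fun n => (\int[leb]_u (k u * I n u))%:E)); last first.
    by apply/funext => n; rewrite -EFin_Rintegral// damped// invr_gt0.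
  apply: cvg_EFin; first exact: nearW.
  apply: (@Rintegral_dominated_cvg _ _ _ leb _ _ (fun u => C * `|k u|)).
  - by move=> n; apply: measurable_funM; [exact: mk|exact: mI].
  - exact: measurable_funX.
  - by move=> u; rewrite expr2; apply: cvgM; [exact: cvg_cst|exact: smooth_limit].
  - by move=> n u; rewrite normrM mulrC ler_wpM2r// smooth_le.
  - by apply: integrable_scale; exact: integrable_norm.
have Ik2 : intg (fun u => k u ^+ 2).
  by under eq_fun do rewrite expr2; apply: (@integrable_mul_bounded _ _ _ leb _ _ _ mk kb).
rewrite -[RHS](EFin_Rintegral Ik2).
have lim2 : (\int[leb]_x (damp (c n) x * N x)%:E)%E @[n --> \oo] -->
    (\int[leb]_x (N x)%:E)%E.
  have cE n x : damp (c n) x <= damp (c n.+1) x.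
    rewrite ler_expR lerN2 ler_wpM2r// ler_pM2l ?mulr_gt0//.
    by rewrite lef_pV2 ?posrE// ler_nat.
  have dlim x : damp (c n) x @[n --> \oo] --> (1 : R).
    rewrite -[X in _ --> X]expR0 -[X in _ --> expR X]oppr0.
    apply: continuous_cvg; first exact: continuous_expR.
    apply: cvgN; rewrite -[X in _ --> X](mul0r `|x|); apply: cvgMl.
    by rewrite -[X in _ --> X](mulr0 (2 * pi)); apply: cvgMr; exact: cvg_harmonic.
  have mdN n : measurable_fun setT (fun x => damp (c n) x * N x).
    exact: integrable_measurable (IN n).
  have H := @cvg_monotone_convergence _ _ _ leb setT measurableT
    (fun n x => (damp (c n) x * N x)%:E).
  have -> : (\int[leb]_x (N x)%:E)%E =
      (\int[leb]_x limn (fun n => (damp (c n) x * N x)%:E))%E.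
    apply: eq_integral => x _; apply/esym/cvg_lim => //.
    apply: cvg_EFin; first exact: nearW.
    by rewrite -[X in _ --> X]mul1r; apply: cvgMl.
  apply: H.
  - by move=> n; apply/measurable_EFinP; exact: mdN.
  - by move=> n x _; rewrite lee_fin mulr_ge0// damp_ge0.
  - move=> x _; apply/nondecreasing_seqP => n.
    by rewrite lee_fin ler_wpM2r.
exact: (cvg_unique _ lim2 lim1).
Qed.

End Plancherel1.

End Kernels.

(** * Plancherel's identity with a parameter *)

Section Plancherel2.
Context {R : realType}.
Local Notation leb := (@lebesgue_measure R).
Local Notation leb2 := (leb \x leb)%E.
Local Notation intg f := (leb.-integrable setT (EFin \o f)).
Local Notation intg2 f := (leb2.-integrable setT (EFin \o f)).
Implicit Types K L : R * R -> R.

Lemma Rintegral_oppr_fst (f : R * R -> R) : measurable_fun setT f ->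
  \int[leb2]_z f (- z.1, z.2) = \int[leb2]_z f z.
Proof.
move=> mf; have mf' := (measurable_EFinP _ _).2 mf.
have mo : measurable_fun setT (fun z : R * R => (- z.1, z.2)).
  by apply: measurable_fun_pair => //; exact: measurable_funN.
have H (g : R * R -> \bar R) : measurable_fun setT g -> (forall z, 0 <= g z)%E ->
    (\int[leb2]_z g (- z.1, z.2)%R = \int[leb2]_z g z)%E.
  move=> mg g0; rewrite fubini_tonelli2//; last exact: (measurableT_comp mg mo).
  rewrite [RHS]fubini_tonelli2//; apply: eq_integral => w _.
  rewrite /fubini_G/= (integral_oppr (f := fun x => g (x, w)))//.
  exact: measurable_fun_pair1.
congr fine; rewrite integralE [RHS]integralE; congr (_ - _)%E.
  rewrite -[RHS]H//; last exact: measurable_funepos.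
  by apply: eq_integral => z _; rewrite !funeposE.
rewrite -[RHS]H//; last exact: measurable_funeneg.
by apply: eq_integral => z _; rewrite !funenegE.
Qed.

Lemma Rintegral_polar (f g h : R * R -> R) : intg2 f -> intg2 g -> intg2 h ->
  \int[leb2]_z (f z + g z + 2 * h z) =
  \int[leb2]_z f z + \int[leb2]_z g z + 2 * \int[leb2]_z h z.
Proof.
move=> If Ig Ih.
rewrite (RintegralD measurableT (integrable_add If Ig) (integrable_scale 2 Ih)).
by rewrite (RintegralD measurableT If Ig) (RintegralZl 2 measurableT Ih).
Qed.

(** A kernel (w, u) |-> K(w, u) whose slices at fixed w satisfy the
assumptions of [plancherel1] with a constant independent of w, and which is
integrable over the plane so that the slices can be integrated in w. *)
Record tame K : Prop := Tame {
  tame_measurable : measurable_fun setT K ;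
  tame_continuous : forall w, continuous (fun u => K (w, u)) ;
  tame_bound : exists C, forall w u, `|K (w, u)| <= C * lorentz u ;
  tame_integrable : intg2 K }.

Lemma tameD K L : tame K -> tame L -> tame (fun z => K z + L z).
Proof.
move=> [mK cK [C hC] iK] [mL cL [D hD] iL]; split.
- exact: measurable_funD.
- by move=> w u; apply: cvgD; [exact: cK|exact: cL].
- exists (C + D) => w u; rewrite mulrDl (le_trans (ler_normD _ _))//.
  by rewrite lerD.
- exact: integrable_add.
Qed.

Lemma tameN K : tame K -> tame (fun z => - K z).
Proof.
move=> [mK cK [C hC] iK]; split.
- exact: measurable_funN.
- by move=> w u; apply: cvgN; exact: cK.
- by exists C => w u; rewrite normrN.
- exact: integrable_opp.
Qed.

Lemma tameB K L : tame K -> tame L -> tame (fun z => K z - L z).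
Proof. by move=> nK nL; apply: tameD => //; exact: tameN. Qed.

Lemma tame_slice K w : tame K -> intg (fun u => K (w, u)).
Proof.
move=> [mK cK [C hC] iK].
apply: (@integrable_le _ _ _ leb _ (fun u => C * lorentz u)) => //.
  exact: measurable_fun_pair2.
by apply: integrable_scale; exact: integrable_lorentz.
Qed.

Lemma tame_mul_integrable K L : tame K -> tame L -> intg2 (fun z => K z * L z).
Proof.
move=> [mK cK [C hC] iK] [mL cL [D hD] iL].
apply: (@integrable_mul_bounded _ _ _ leb2 _ _ D) => // -[w u].
rewrite (le_trans (hD _ _))// ler_piMr ?lorentz_le1//.
by have := le_trans (normr_ge0 _) (hD 0 0); rewrite pmulr_lge0 ?lorentz_gt0.
Qed.

(** At z = (x, w): the transform in u of the slice of K at w, evaluated at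
frequency x. *)
Definition cosT K (z : R * R) : R := cos_transform (fun u => K (z.2, u)) z.1.
Definition sinT K (z : R * R) : R := sin_transform (fun u => K (z.2, u)) z.1.

Lemma measurable_phase_arg :
  measurable_fun setT (fun q : (R * R) * R => 2 * pi * (q.1.1 * q.2)).
Proof.
apply: measurable_funM => //; apply: measurable_funM => //.
exact: measurableT_comp.
Qed.

Lemma measurable_slice K : measurable_fun setT K ->
  measurable_fun setT (fun q : (R * R) * R => K (q.1.2, q.2)).
Proof.
move=> mK.
apply: (measurableT_comp mK (g := fun q : (R * R) * R => (q.1.2, q.2))).
by apply: measurable_fun_pair => //; exact: measurableT_comp.
Qed.

Lemma measurable_cosT K : measurable_fun setT K -> measurable_fun setT (cosT K).
Proof.
move=> mK; apply: (measurable_Rintegral (F := fun q : (R * R) * R =>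
  K (q.1.2, q.2) * cos (2 * pi * (q.1.1 * q.2)))).
apply: measurable_funM; first exact: measurable_slice.
apply: (measurableT_comp (continuous_measurable_fun (@continuous_cos R))).
exact: measurable_phase_arg.
Qed.

Lemma measurable_sinT K : measurable_fun setT K -> measurable_fun setT (sinT K).
Proof.
move=> mK; apply: (measurable_Rintegral (F := fun q : (R * R) * R =>
  K (q.1.2, q.2) * sin (2 * pi * (q.1.1 * q.2)))).
apply: measurable_funM; first exact: measurable_slice.
apply: (measurableT_comp (continuous_measurable_fun (@continuous_sin R))).
exact: measurable_phase_arg.
Qed.

Lemma tame_cos_integrable K x w : tame K ->
  intg (fun u => K (w, u) * cos (2 * pi * (x * u))).
Proof.
move=> nK; apply: (@integrable_mul_bounded _ _ _ leb _ _ 1).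
- apply: continuous_measurable_fun.
  rewrite (_ : (fun u => _) = (fun u => cos (2 * pi * x * u))).
    exact/continuous_trig/continuous_cos.
  by apply/funext => u; rewrite mulrA.
- by move=> u; exact: cos_max.
- exact: tame_slice.
Qed.

Lemma tame_sin_integrable K x w : tame K ->
  intg (fun u => K (w, u) * sin (2 * pi * (x * u))).
Proof.
move=> nK; apply: (@integrable_mul_bounded _ _ _ leb _ _ 1).
- apply: continuous_measurable_fun.
  rewrite (_ : (fun u => _) = (fun u => sin (2 * pi * x * u))).
    exact/continuous_trig/continuous_sin.
  by apply/funext => u; rewrite mulrA.
- by move=> u; exact: sin_max.
- exact: tame_slice.
Qed.

Lemma cosTD K L z : tame K -> tame L ->
  cosT (fun z => K z + L z) z = cosT K z + cosT L z.
Proof.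
move=> nK nL; rewrite /cosT /cos_transform -RintegralD//; last 2 first.
- exact: tame_cos_integrable.
- exact: tame_cos_integrable.
by apply: eq_Rintegral => u _; rewrite mulrDl.
Qed.

Lemma sinTD K L z : tame K -> tame L ->
  sinT (fun z => K z + L z) z = sinT K z + sinT L z.
Proof.
move=> nK nL; rewrite /sinT /sin_transform -RintegralD//; last 2 first.
- exact: tame_sin_integrable.
- exact: tame_sin_integrable.
by apply: eq_Rintegral => u _; rewrite mulrDl.
Qed.

Lemma cosT_bounded K : tame K -> exists M, forall z, `|cosT K z| <= M.
Proof.
move=> nK; have [mK _ [C hC] _] := nK.
exists (\int[leb]_u (C * lorentz u)) => -[x w].
apply: normr_Rintegral_le.
- by apply: integrable_scale; exact: integrable_lorentz.
- exact: integrable_measurable (tame_cos_integrable x w nK).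
- move=> u /=; rewrite normrM (le_trans _ (hC w u))// ler_piMr// cos_max//.
Qed.

Lemma sinT_bounded K : tame K -> exists M, forall z, `|sinT K z| <= M.
Proof.
move=> nK; have [mK _ [C hC] _] := nK.
exists (\int[leb]_u (C * lorentz u)) => -[x w].
apply: normr_Rintegral_le.
- by apply: integrable_scale; exact: integrable_lorentz.
- exact: integrable_measurable (tame_sin_integrable x w nK).
- move=> u /=; rewrite normrM (le_trans _ (hC w u))// ler_piMr// sin_max//.
Qed.

Lemma energyE K : tame K ->
  (\int[leb2]_z (cosT K z ^+ 2 + sinT K z ^+ 2)%:E =
   \int[leb2]_z (K z ^+ 2)%:E)%E.
Proof.
move=> nK; have [mK cK [C hC] iK] := nK.
rewrite fubini_tonelli2; last 2 first.
- apply/measurable_EFinP; apply: measurable_funD; apply: measurable_funX.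
    exact: measurable_cosT.
  exact: measurable_sinT.
- by move=> z; rewrite lee_fin addr_ge0 ?sqr_ge0.
rewrite fubini_tonelli1; last 2 first.
- by apply/measurable_EFinP; exact: measurable_funX.
- by move=> z; rewrite lee_fin sqr_ge0.
by apply: eq_integral => w _; exact: (plancherel1 (cK w) (hC w)).
Qed.

Lemma energy_integrable K : tame K ->
  intg2 (fun z => cosT K z ^+ 2 + sinT K z ^+ 2).
Proof.
move=> nK; have mK := tame_measurable nK.
apply/integrableP; split.
  apply/measurable_EFinP; apply: measurable_funD; apply: measurable_funX.
    exact: measurable_cosT.
  exact: measurable_sinT.
under eq_integral do rewrite /= ger0_norm ?addr_ge0 ?sqr_ge0//.
rewrite energyE// -EFin_Rintegral ?ltry//.
exact: tame_mul_integrable.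
Qed.

(** Indexing the two transforms by a boolean lets the four kinds of products
be treated at once. *)
Definition trig (b : bool) := if b then sinT else cosT.

(** Both transforms are square integrable, their squares adding up to an
integrable function. *)
Lemma trig_mul_integrable (b c : bool) K L : tame K -> tame L ->
  intg2 (fun z => trig b K z * trig c L z).
Proof.
move=> nK nL; have mK := tame_measurable nK; have mL := tame_measurable nL.
have mT d M : measurable_fun setT M -> measurable_fun setT (trig d M).
  by case: d; [exact: measurable_sinT|exact: measurable_cosT].
apply: (integrable_le _ _ (integrable_add (energy_integrable nK) (energy_integrable nL))).
  by apply: measurable_funM; exact: mT.
move=> z.
have h d M : `|trig d M z| ^+ 2 <= cosT M z ^+ 2 + sinT M z ^+ 2.
  by rewrite real_normK ?num_real//; case: d; rewrite /= ?lerDl ?lerDr sqr_ge0.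
rewrite normrM (le_trans _ (lerD (h b K) (h c L)))//.
have := sqr_ge0 (`|trig b K z| - `|trig c L z|).
have := mulr_ge0 (normr_ge0 (trig b K z)) (normr_ge0 (trig c L z)).
by rewrite sqrrB; nra.
Qed.

(** Polarization of [energyE]. *)
Lemma plancherel2 K L : tame K -> tame L ->
  \int[leb2]_z (cosT K z * cosT L z + sinT K z * sinT L z) =
  \int[leb2]_z (K z * L z).
Proof.
move=> nK nL.
have E M : tame M -> \int[leb2]_z (cosT M z ^+ 2 + sinT M z ^+ 2) =
    \int[leb2]_z (M z * M z).
  move=> nM; rewrite /Rintegral energyE//.
have iP := integrable_add (trig_mul_integrable false false nK nL)
  (trig_mul_integrable true true nK nL).
have h1 := Rintegral_polar (energy_integrable nK) (energy_integrable nL) iP.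
have h2 := Rintegral_polar (tame_mul_integrable nK nK)
  (tame_mul_integrable nL nL) (tame_mul_integrable nK nL).
have h3 := E _ (tameD nK nL).
rewrite (E _ nK) (E _ nL) /= in h1.
have e1 : \int[leb2]_z (cosT (fun z => K z + L z) z ^+ 2 +
    sinT (fun z => K z + L z) z ^+ 2) =
    \int[leb2]_z (cosT K z ^+ 2 + sinT K z ^+ 2 +
    (cosT L z ^+ 2 + sinT L z ^+ 2) +
    2 * (cosT K z * cosT L z + sinT K z * sinT L z)).
  by apply: eq_Rintegral => z _; rewrite cosTD// sinTD//; ring.
have e2 : \int[leb2]_z ((K z + L z) * (K z + L z)) =
    \int[leb2]_z (K z * K z + L z * L z + 2 * (K z * L z)).
  by apply: eq_Rintegral => z _; ring.
by move: h1 h2 h3; rewrite e1 e2 => -> -> /addrI;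
  apply: mulfI; rewrite pnatr_eq0.
Qed.

(** In x the cosine transform is even and the sine transform is odd. *)
Lemma plancherel2_cross K L : tame K -> tame L ->
  \int[leb2]_z (cosT K z * sinT L z) = 0.
Proof.
move=> nK nL.
have : \int[leb2]_z (cosT K z * sinT L z) = - \int[leb2]_z (cosT K z * sinT L z).
  rewrite -RintegralN -(Rintegral_oppr_fst (f := fun z => cosT K z * sinT L z)).
    apply: eq_Rintegral => -[x w] _ /=.
    rewrite -mulrN; congr (_ * _).
      by apply: eq_Rintegral => u _ /=; rewrite mulNr mulrN cosN.
    rewrite -RintegralN.
    by apply: eq_Rintegral => u _ /=; rewrite mulNr mulrN sinN mulrN.
  exact: integrable_measurable (trig_mul_integrable false true nK nL).
lra.
Qed.

End Plancherel2.

(** * Kernels that are products in sheared coordinates *)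

Section Twist.
Context {R : realType}.
Local Notation leb := (@lebesgue_measure R).
Local Notation leb2 := (leb \x leb)%E.
Local Notation intg f := (leb.-integrable setT (EFin \o f)).
Local Notation intg2 f := (leb2.-integrable setT (EFin \o f)).

(** The properties of t |-> psi(e^t), for psi in the Schwartz space of the
half-line, on which everything below relies. *)
Definition decaying (f : R -> R) : Prop :=
  continuous f /\ exists C, forall t, `|f t| <= C * lorentz t.

Lemma decaying_measurable f : decaying f -> measurable_fun setT f.
Proof. by move=> [cf _]; exact: continuous_measurable_fun. Qed.

Lemma decaying_integrable f : decaying f -> intg f.
Proof.
move=> df; have [cf [C hC]] := df.
apply: (@integrable_le _ _ _ leb _ (fun u => C * lorentz u)) => //.
  exact: decaying_measurable.
by apply: integrable_scale; exact: integrable_lorentz.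
Qed.

Lemma decaying_bounded f : decaying f -> exists M, forall t, `|f t| <= M.
Proof.
move=> [_ [C hC]]; exists C => t; rewrite (le_trans (hC t))//.
rewrite ler_piMr ?lorentz_le1//.
by have := le_trans (normr_ge0 _) (hC 0); rewrite pmulr_lge0 ?lorentz_gt0.
Qed.

Lemma decayingM f g : decaying f -> decaying g -> decaying (fun t => f t * g t).
Proof.
move=> [cf [C hC]] dg; have [cg _] := dg; have [M hM] := decaying_bounded dg.
split; first by move=> t; apply: cvgM; [exact: cf|exact: cg].
exists (C * M) => t; rewrite normrM mulrAC.
by apply: ler_pM.
Qed.

Lemma decayingD f g : decaying f -> decaying g -> decaying (fun t => f t + g t).
Proof.
move=> [cf [C hC]] [cg [D hD]].
split; first by move=> t; apply: cvgD; [exact: cf|exact: cg].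
exists (C + D) => t; rewrite mulrDl (le_trans (ler_normD _ _))//.
by rewrite lerD.
Qed.

Lemma decayingN f : decaying f -> decaying (fun t => - f t).
Proof.
move=> [cf [C hC]]; split; first by move=> t; apply: cvgN; exact: cf.
by exists C => t; rewrite normrN.
Qed.

(** Since u = p - (p - u), the number 1 + u^2 is at most twice (1 + p^2) (1 +
(p - u)^2). *)
Lemma lorentzM_le (p u : R) : lorentz p * lorentz (p - u) <= 2 * lorentz u.
Proof.
have pos t : 0 < 1 + t ^+ 2 :> R by rewrite ltr_pwDl// sqr_ge0.
rewrite /lorentz -invfM -ler_pdivrMl// -invfM lef_pV2 ?posrE; last 2 first.
- by apply: mulr_gt0 => //; apply: mulr_gt0; exact: pos.
- exact: pos.
have := sqr_ge0 (p + (p - u)); have := sqr_ge0 (p * (p - u)); nra.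
Qed.

(** The product f (x) g pulled back along the shear (w, u) |-> (w + l(u), w +
l(u) - u). *)
Definition twist (l f g : R -> R) (z : R * R) : R :=
  f (z.1 + l z.2) * g (z.1 + l z.2 - z.2).

Lemma measurable_twist l f g : measurable_fun setT l -> measurable_fun setT f ->
  measurable_fun setT g -> measurable_fun setT (twist l f g).
Proof.
move=> ml mf mg.
have ma : measurable_fun setT (fun z : R * R => z.1 + l z.2).
  by apply: measurable_funD => //; exact: measurableT_comp.
apply: measurable_funM; first exact: (measurableT_comp mf).
by apply: (measurableT_comp mg); exact: measurable_funB.
Qed.

Lemma tonelli_swap (f : R * R -> \bar R) : measurable_fun setT f ->
  (forall z, 0 <= f z)%E ->
  (\int[leb]_x \int[leb]_y f (x, y) = \int[leb]_y \int[leb]_x f (x, y))%E.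
Proof. by move=> mf f0; exact: (@fubini_tonelli _ _ _ _ R leb leb f mf f0). Qed.

(** For fixed u a shift in w removes l; then, for fixed p, a shift and a
reflection in u separate the two factors. *)
Lemma twist_integrable l f g : measurable_fun setT l -> intg f -> intg g ->
  intg2 (twist l f g).
Proof.
move=> ml If Ig.
have mf := integrable_measurable If; have mg := integrable_measurable Ig.
have mt k : measurable_fun setT k -> measurable_fun setT (twist k f g).
  by move=> mk; exact: measurable_twist.
have inner k : measurable_fun setT k ->
    (\int[leb]_u \int[leb]_w `|(EFin \o twist k f g) (w, u)| =
     \int[leb]_u \int[leb]_p `|(EFin \o twist (cst 0%R) f g) (p, u)|)%E.
  move=> mk; apply: eq_integral => u _.
  rewrite -(integral_shift (k u) (f := fun p => `|(EFin \o twist (cst 0%R) f g) (p, u)|%E)).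
    by apply: eq_integral => w _ /=; rewrite /twist/= addr0.
  apply: measurableT_comp => //; apply/measurable_EFinP.
  by apply: measurable_fun_pair1; apply: mt; exact: measurable_cst.
apply/integrable21ltyP; first by apply/measurable_EFinP; exact: mt.
rewrite inner//.
apply: (@le_lt_trans _ _ (\int[leb]_x \int[leb]_y
    (abse \o (EFin \o twist (cst 0%R) f g)) (x, y))%E).
  rewrite le_eqVlt; apply/orP; left; apply/eqP/esym.
  apply: (tonelli_swap (f := abse \o (EFin \o twist (cst 0) f g))) => [|z];
    last exact: abse_ge0.
  apply: measurableT_comp => //; apply/measurable_EFinP.
  by apply: mt; exact: measurable_cst.
have If' := integrable_norm If; have Ig' := integrable_norm Ig.
have -> : (\int[leb]_x \int[leb]_y (abse \o (EFin \o twist (cst 0%R) f g)) (x, y) =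
    \int[leb]_x (`|f x|%:E * \int[leb]_y (`|g y|%:E)))%E.
  apply: eq_integral => p _.
  rewrite -(integral_oppr (f := fun y => `|g y|%:E)); last first.
    by apply/measurable_EFinP; exact: measurableT_comp.
  rewrite -(integral_shift (- p) (f := fun y => `|g (- y)|%:E)); last first.
    apply/measurable_EFinP; apply: measurableT_comp => //.
    by apply: measurableT_comp => //; exact: measurable_funN.
  rewrite -ge0_integralZl//; last first.
    apply/measurable_EFinP; apply: measurableT_comp => //.
    apply: (measurableT_comp mg); apply: measurable_funN.
    exact: measurable_funD.
  apply: eq_integral => u _ /=; rewrite /twist/= addr0 normrM EFinM.
  by rewrite opprD opprK addrC.
rewrite -(EFin_Rintegral Ig').
under eq_integral do rewrite -EFinM.
rewrite -EFin_Rintegral ?ltry//.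
have := integrable_scale (\int[leb]_x `|g x|) If'.
by congr (integrable _ _ _); apply/funext => x /=; rewrite mulrC.
Qed.

Lemma integrable_shift f c : intg f -> intg (fun x => f (x + c)).
Proof.
move=> If; have mf := integrable_measurable If.
apply/integrableP; split.
  apply/measurable_EFinP; apply: (measurableT_comp mf).
  exact: measurable_funD.
rewrite (integral_shift c (f := fun x => `|(f x)%:E|%E)).
  by have /integrableP[] := If.
by apply: measurableT_comp => //; exact/measurable_EFinP.
Qed.

Lemma integrable_oppr f : intg f -> intg (fun x => f (- x)).
Proof.
move=> If; have mf := integrable_measurable If.
apply/integrableP; split.
  apply/measurable_EFinP; apply: (measurableT_comp mf).
  exact: measurable_funN.
rewrite (integral_oppr (f := fun x => `|(f x)%:E|%E)).
  by have /integrableP[] := If.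
by apply: measurableT_comp => //; exact/measurable_EFinP.
Qed.

Lemma tame_twist l f g : continuous l -> decaying f -> decaying g ->
  tame (twist l f g).
Proof.
move=> cl df dg; have [cf [C hC]] := df; have [cg [D hD]] := dg.
have ml := continuous_measurable_fun cl.
split.
- by apply: measurable_twist => //; exact: decaying_measurable.
- move=> w u.
  have ca : {for u, continuous (fun u => w + l u)}.
    by apply: cvgD; [exact: cvg_cst|exact: cl].
  apply: cvgM; first by apply: continuous_comp => //; exact: cf.
  apply: (@continuous_comp _ _ _ (fun u => w + l u - u) g); last exact: cg.
  by apply: cvgB; [exact: ca|exact: cvg_id].
- exists (C * D * 2) => w u; rewrite normrM.
  rewrite (le_trans (ler_pM _ _ (hC _) (hD _)))//.
  rewrite mulrACA -[leRHS]mulrA ler_wpM2l ?lorentzM_le// mulr_ge0//.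
    by have := le_trans (normr_ge0 _) (hC 0); rewrite pmulr_lge0 ?lorentz_gt0.
  by have := le_trans (normr_ge0 _) (hD 0); rewrite pmulr_lge0 ?lorentz_gt0.
- by apply: twist_integrable => //; exact: decaying_integrable.
Qed.

(** The shear preserves Lebesgue measure: for fixed u it is a shift in w,
which reduces to the case l = 0, and there u |-> p - u preserves the measure
for fixed p. *)
Lemma Rintegral_twist l a b : continuous l -> decaying a -> decaying b ->
  \int[leb2]_z twist l a b z = \int[leb]_p a p * \int[leb]_q b q.
Proof.
move=> cl da db.
have ml := continuous_measurable_fun cl.
have ma := decaying_measurable da; have mb := decaying_measurable db.
have ia := decaying_integrable da; have ib := decaying_integrable db.
have [M hM] := decaying_bounded db.
have c0 : continuous (cst 0 : R -> R) by move=> ?; exact: cvg_cst.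
have i1 k u : intg (fun w => twist k a b (w, u)).
  apply: (@integrable_mul_bounded _ _ _ leb _ _ M).
  - apply: (measurableT_comp mb); apply: measurable_funB => //=.
    exact: measurable_funD.
  - by move=> w; exact: hM.
  - exact: (integrable_shift (k u) ia).
have ibp p : intg (fun u => b (p - u)).
  have := integrable_shift (- p) (integrable_oppr ib).
  congr (integrable _ _ _); apply/funext => u /=.
  by rewrite opprD opprK addrC.
have i2 p : intg (fun u => twist (cst 0) a b (p, u)).
  rewrite /twist/= addr0; apply: integrable_scale; exact: ibp.
have it k : continuous k -> intg2 (twist k a b).
  by move=> ck; apply: twist_integrable => //; exact: continuous_measurable_fun.
rewrite (Rintegral21 (it l cl) (i1 l)).
transitivity (\int[leb2]_z twist (cst 0) a b z).
  rewrite (Rintegral21 (it _ c0) (i1 _)).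
  apply: eq_Rintegral => u _.
  rewrite -(Rintegral_shift (l u) (f := fun p => twist (cst 0) a b (p, u))).
    by apply: eq_Rintegral => w _; rewrite /twist/= addr0.
  exact: integrable_measurable (i1 _ _).
rewrite (Rintegral12 (it _ c0) i2).
rewrite -RintegralZr//; apply: eq_Rintegral => p _.
rewrite /twist/= addr0 RintegralZl//; congr (_ * _).
rewrite -[RHS](Rintegral_oppr mb) -[RHS](Rintegral_shift (- p)).
  by apply: eq_Rintegral => u _; rewrite opprD opprK addrC.
apply: (measurableT_comp mb); exact: measurable_funN.
Qed.

End Twist.

(** * The function lambda *)

Local Open Scope complex_scope.

Section Lam.
Context {R : realType}.

Lemma expR_neq1 (u : R) : u != 0 -> expR u - 1 != 0.
Proof.
apply: contra => /eqP h; apply/eqP.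
by rewrite -(expRK u) (subr0_eq h) ln1.
Qed.

Lemma lamN (u : R) : lam (- u) = lam u * expR (- u).
Proof.
rewrite /lam oppr_eq0; have [->|u0] := eqVneq u 0; first by rewrite oppr0 expR0 mulr1.
have e1 := expR_neq1 u0.
have e0 : expR u != 0 by rewrite gt_eqF ?expR_gt0.
rewrite expRN; have e2 : 1 - expR u != 0 by rewrite -oppr_eq0 opprB.
have -> : (expR u)^-1 - 1 = (1 - expR u) / expR u.
  by rewrite mulrBl mul1r mulfV.
by field; rewrite e0 e1 e2.
Qed.

(** With lambda(- u) = lambda(u) e^(- u), this is u (e^u - 1) / (e^u - 1) = u.
*)
Lemma lamB (u : R) : lam u - lam (- u) = u.
Proof.
rewrite lamN /lam; have [->|u0] := eqVneq u 0.
  by rewrite oppr0 expR0 mulr1 subrr.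
have e1 := expR_neq1 u0.
have e0 : expR u != 0 by rewrite gt_eqF ?expR_gt0.
by rewrite expRN; field; rewrite e0 e1.
Qed.

Lemma lam_gt0 (u : R) : 0 < lam u.
Proof.
rewrite /lam; have [//|u0] := eqVneq u 0.
have [un|up] := ltP u 0.
  rewrite -mulrA nmulr_rgt0// pmulr_rlt0 ?expR_gt0// invr_lt0 subr_lt0.
  by rewrite -expR0 ltr_expR.
have {}up : 0 < u by rewrite lt_neqAle eq_sym u0.
rewrite divr_gt0 ?mulr_gt0 ?expR_gt0//.
by rewrite subr_gt0 -expR0 ltr_expR.
Qed.

(** At 0, differentiability of the exponential gives e^z - 1 = g(z) z with g
continuous and g(0) = 1, so that lambda = exp / g there. *)
Lemma continuous_lam : continuous (@lam R).
Proof.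
move=> u; have [->|u0] := eqVneq u 0.
  have /is_derive1_caratheodory[g [gE cg g0]] := is_derive_expR (0 : R).
  rewrite expR0 in g0.
  have lamE : @lam R = (fun z => expR z / g z).
    apply/funext => z; rewrite /lam; have [->|z0] := eqVneq z 0.
      by rewrite expR0 g0 invr1 mulr1.
    have := gE z; rewrite expR0 subr0 => h.
    have gz0 : g z != 0.
      by apply: contraNN (expR_neq1 z0) => /eqP gz; rewrite h gz mul0r.
    by rewrite h; field; rewrite z0 gz0.
  rewrite lamE; apply: cvgM; first exact: continuous_expR.
  by apply: cvgV => //; rewrite g0 oner_neq0.
apply: (@cvg_trans _ ((fun z : R => z * expR z / (expR z - 1)) @ u)).
  apply: near_eq_cvg; near=> z.
  rewrite /lam; case: ifPn => // /eqP z0; exfalso.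
  suff : z != 0 by rewrite z0 eqxx.
  near: z; apply/nbhs_ballP; exists `|u|; first by rewrite /= normr_gt0.
  by move=> y; rewrite /ball/=; apply: contraTneq => ->; rewrite subr0 ltxx.
have -> : lam u = u * expR u / (expR u - 1) by rewrite /lam (negbTE u0).
change ((fun z : R => z * expR z / (expR z - 1)) @ u --> u * expR u / (expR u - 1)).
apply: cvgM.
  by apply: cvgM; [exact: cvg_id|exact: continuous_expR].
apply: cvgV; first exact: expR_neq1.
by apply: cvgB; [exact: continuous_expR|exact: cvg_cst].
Unshelve. all: by end_near. Qed.

Definition loglam (u : R) : R := ln (lam u).

Lemma continuous_loglam : continuous loglam.
Proof.
move=> u; apply: continuous_comp; first exact: continuous_lam.
exact/continuous_ln/lam_gt0.
Qed.

Lemma expR_lam w u : expR w * lam u = expR (w + loglam u) :> R.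
Proof. by rewrite expRD lnK// posrE lam_gt0. Qed.

Lemma expR_lamN w u : expR w * lam (- u) = expR (w + loglam u - u) :> R.
Proof. by rewrite lamN mulrA expR_lam -expRD. Qed.

End Lam.

(** * Real and imaginary parts *)

Section ComplexParts.
Context {R : realType}.
Implicit Types z w : R[i].

Lemma Re_mul z w :
  complex.Re (z * w) = complex.Re z * complex.Re w - complex.Im z * complex.Im w.
Proof. by case: z w => [a b] [c d]. Qed.
Lemma Im_mul z w :
  complex.Im (z * w) = complex.Re z * complex.Im w + complex.Im z * complex.Re w.
Proof. by case: z w => [a b] [c d]. Qed.
Lemma Re_add z w : complex.Re (z + w) = complex.Re z + complex.Re w.
Proof. by case: z w => [a b] [c d]. Qed.
Lemma Im_add z w : complex.Im (z + w) = complex.Im z + complex.Im w.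
Proof. by case: z w => [a b] [c d]. Qed.
Lemma Re_opp z : complex.Re (- z) = - complex.Re z.
Proof. by case: z => [a b]. Qed.
Lemma Im_opp z : complex.Im (- z) = - complex.Im z.
Proof. by case: z => [a b]. Qed.
Lemma Re_conj z : complex.Re (conjc z) = complex.Re z.
Proof. by case: z => [a b]. Qed.
Lemma Im_conj z : complex.Im (conjc z) = - complex.Im z.
Proof. by case: z => [a b]. Qed.
Lemma eq_complexP z w : complex.Re z = complex.Re w -> complex.Im z = complex.Im w -> z = w.
Proof. by case: z w => [a b] [c d] /= -> ->. Qed.

Definition complexE := (Re_mul, Im_mul, Re_add, Im_add, Re_opp, Im_opp, Re_conj, Im_conj).

Lemma normc_ge_Re z : `|complex.Re z| <= Normc.normc z.
Proof.
case: z => [a b] /=; rewrite -sqrtr_sqr ler_wsqrtr// lerDl sqr_ge0//.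
Qed.
Lemma normc_ge_Im z : `|complex.Im z| <= Normc.normc z.
Proof.
case: z => [a b] /=; rewrite -sqrtr_sqr ler_wsqrtr// lerDr sqr_ge0//.
Qed.
Lemma normc_le_ReIm z : Normc.normc z <= `|complex.Re z| + `|complex.Im z|.
Proof.
case: z => [a b] /=.
rewrite -[leRHS]ger0_norm ?addr_ge0// -sqrtr_sqr ler_wsqrtr//.
rewrite sqrrD !real_normK ?num_real// addrAC lerDl mulrn_wge0//.
Qed.

End ComplexParts.

(** * The Wigner transform in logarithmic coordinates *)

Section WignerParts.
Context {R : realType}.
Local Notation leb := (@lebesgue_measure R).
Local Notation leb2 := (leb \x leb)%E.
Local Notation intg f := (leb.-integrable setT (EFin \o f)).
Local Notation intg2 f := (leb2.-integrable setT (EFin \o f)).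

Definition logRe (psi : R -> R[i]) (t : R) : R := complex.Re (psi (expR t)).
Definition logIm (psi : R -> R[i]) (t : R) : R := complex.Im (psi (expR t)).

(** The seminorms of orders 0 and 2 without derivatives add up to a bound on
(1 + t^2) |psi(e^t)|. *)
Lemma schwartz_decaying (psi : R -> R[i]) : schwartz_Rpos psi ->
  decaying (logRe psi) /\ decaying (logIm psi).
Proof.
move=> [_ [sm bd]].
have [C0 h0] := bd 0%N 0%N; have [C2 h2] := bd 2%N 0%N.
have h t : Normc.normc (psi (expR t)) <= (C0 + C2) * lorentz t.
  rewrite /lorentz ler_pdivlMr ?ltr_pwDl ?sqr_ge0//.
  have := h0 t; have := h2 t; rewrite /= expr0 mul1r real_normK ?num_real//.
  lra.
split; split.
- move=> t; have [/= d1 _] := sm 0%N t I.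
  by apply: differentiable_continuous; exact/derivable1_diffP.
- by exists (C0 + C2) => t; rewrite (le_trans (normc_ge_Re _)).
- move=> t; have [/= _ d2] := sm 0%N t I.
  by apply: differentiable_continuous; exact/derivable1_diffP.
- by exists (C0 + C2) => t; rewrite (le_trans (normc_ge_Im _)).
Qed.

Variables psi phi : R -> R[i].
Hypotheses (spsi : schwartz_Rpos psi) (sphi : schwartz_Rpos phi).

(** With [kerIm], the complex kernel psi(e^(w + l(u))) conj(phi(e^(w + l(u) -
u))) whose Fourier transform in u is W(x, e^w), with parts [wigRe] and
[wigIm]. *)
Definition kerRe (psi phi : R -> R[i]) (z : R * R) : R :=
  twist loglam (logRe psi) (logRe phi) z + twist loglam (logIm psi) (logIm phi) z.
Definition kerIm (psi phi : R -> R[i]) (z : R * R) : R :=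
  twist loglam (logIm psi) (logRe phi) z - twist loglam (logRe psi) (logIm phi) z.
Definition wigRe (psi phi : R -> R[i]) (z : R * R) : R :=
  cosT (kerRe psi phi) z + sinT (kerIm psi phi) z.
Definition wigIm (psi phi : R -> R[i]) (z : R * R) : R :=
  cosT (kerIm psi phi) z - sinT (kerRe psi phi) z.

Lemma tame_kerRe : tame (kerRe psi phi).
Proof.
have [? ?] := schwartz_decaying spsi; have [? ?] := schwartz_decaying sphi.
by apply: tameD; apply: tame_twist => //; exact: continuous_loglam.
Qed.

Lemma tame_kerIm : tame (kerIm psi phi).
Proof.
have [? ?] := schwartz_decaying spsi; have [? ?] := schwartz_decaying sphi.
by apply: tameB; apply: tame_twist => //; exact: continuous_loglam.
Qed.

Definition wigner_integrand (psi phi : R -> R[i]) (x a u : R) : R[i] :=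
  psi (a * lam u) * conjc (phi (a * lam (- u))) * cis (- (2 * pi * x * u)).

Lemma wigner_integrand_log x w u : wigner_integrand psi phi x (expR w) u =
  (kerRe psi phi (w, u) * cos (2 * pi * (x * u)) +
   kerIm psi phi (w, u) * sin (2 * pi * (x * u)))
  +i* (kerIm psi phi (w, u) * cos (2 * pi * (x * u)) -
       kerRe psi phi (w, u) * sin (2 * pi * (x * u))).
Proof.
rewrite /wigner_integrand expR_lam expR_lamN -(mulrA (2 * pi)).
rewrite /kerRe /kerIm /twist /logRe /logIm /=.
by apply: eq_complexP; rewrite !complexE /= cosN sinN; ring.
Qed.

Lemma wigner_log z : wigner psi phi (z.1, expR z.2) =
  wigRe psi phi z +i* wigIm psi phi z.
Proof.
case: z => x w /=.
have nR := tame_kerRe; have nI := tame_kerIm.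
rewrite /wigner /cintegral /=; congr (_ +i* _).
  rewrite /wigRe /cosT /sinT /cos_transform /sin_transform /= -RintegralD//; last 2 first.
  - exact: tame_cos_integrable.
  - exact: tame_sin_integrable.
  by apply: eq_Rintegral => u _; rewrite -/(wigner_integrand _ _ _ _ _) wigner_integrand_log.
rewrite /wigIm /cosT /sinT /cos_transform /sin_transform /= -RintegralB//; last 2 first.
- exact: tame_cos_integrable.
- exact: tame_sin_integrable.
by apply: eq_Rintegral => u _; rewrite -/(wigner_integrand _ _ _ _ _) wigner_integrand_log.
Qed.

Lemma measurable_wigRe : measurable_fun setT (wigRe psi phi).
Proof.
apply: measurable_funD.
  exact: measurable_cosT (tame_measurable tame_kerRe).
exact: measurable_sinT (tame_measurable tame_kerIm).
Qed.

Lemma measurable_wigIm : measurable_fun setT (wigIm psi phi).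
Proof.
apply: measurable_funB.
  exact: measurable_cosT (tame_measurable tame_kerIm).
exact: measurable_sinT (tame_measurable tame_kerRe).
Qed.

Lemma wig_bounded : exists M : R, 0 <= M /\
  forall z, `|wigRe psi phi z| <= M /\ `|wigIm psi phi z| <= M.
Proof.
have [M1 h1] := cosT_bounded tame_kerRe; have [M2 h2] := sinT_bounded tame_kerIm.
have [M3 h3] := cosT_bounded tame_kerIm; have [M4 h4] := sinT_bounded tame_kerRe.
have p1 := le_trans (normr_ge0 _) (h1 0); have p2 := le_trans (normr_ge0 _) (h2 0).
have p3 := le_trans (normr_ge0 _) (h3 0); have p4 := le_trans (normr_ge0 _) (h4 0).
exists (M1 + M2 + (M3 + M4)); split; first by rewrite !addr_ge0.
move=> z; split.
  by rewrite (le_trans (ler_normD _ _))// (le_trans (lerD (h1 z) (h2 z)))// lerDl addr_ge0.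
by rewrite (le_trans (ler_normB _ _))// (le_trans (lerD (h3 z) (h4 z)))// lerDr addr_ge0.
Qed.

(** In the integral defining the right-hand side, the two factors U contribute
the phase 2 pi x (lambda(u) - lambda(- u)) = 2 pi x u; complex conjugation and
u |-> - u then give the integral defining W. *)
Lemma wigner_parity (x a : R) : 0 < a ->
  wigner psi phi (x, a) = conv_rank_one_parity psi phi (x, a).
Proof.
move=> a0; rewrite -(lnK (a0 : a \in Num.pos)); set w := ln a.
have nR := tame_kerRe; have nI := tame_kerIm.
have conjE u : conjc (U (- x) (expR w) phi (1 * lam u) *
    conjc (U (- x) (expR w) psi (1 * lam (- u))) * cis (- (2 * pi * 0 * u))) =
    wigner_integrand psi phi x (expR w) (- u).
  rewrite /U /wigner_integrand !mul1r !opprK mulr0 mul0r oppr0.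
  have xE : 2 * pi * x * u = 2 * pi * x * lam u - 2 * pi * x * lam (- u).
    by rewrite -mulrBr lamB.
  rewrite !mulrN !mulNr !opprK xE.
  by apply: eq_complexP; rewrite !complexE /= cosB sinB !cosN !sinN cos0 sin0; ring.
have mRe : measurable_fun setT
    (fun u => complex.Re (wigner_integrand psi phi x (expR w) u)).
  rewrite (_ : (fun u => _) = (fun u =>
      kerRe psi phi (w, u) * cos (2 * pi * (x * u)) +
      kerIm psi phi (w, u) * sin (2 * pi * (x * u)))); last first.
    by apply/funext => u; rewrite wigner_integrand_log.
  apply: (@integrable_measurable _ _ _ leb); apply: integrable_add.
    exact: tame_cos_integrable.
  exact: tame_sin_integrable.
have mIm : measurable_fun setT
    (fun u => complex.Im (wigner_integrand psi phi x (expR w) u)).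
  rewrite (_ : (fun u => _) = (fun u =>
      kerIm psi phi (w, u) * cos (2 * pi * (x * u)) -
      kerRe psi phi (w, u) * sin (2 * pi * (x * u)))); last first.
    by apply/funext => u; rewrite wigner_integrand_log.
  apply: (@integrable_measurable _ _ _ leb); apply: integrable_sub.
    exact: tame_cos_integrable.
  exact: tame_sin_integrable.
rewrite /conv_rank_one_parity /parity /weyl_quant /delta_one /wigner /cintegral /=.
congr (_ +i* _).
  rewrite -(Rintegral_oppr mRe).
  by apply: eq_Rintegral => u _; rewrite -conjE Re_conj.
rewrite -RintegralN -(Rintegral_oppr mIm).
by apply: eq_Rintegral => u _; rewrite -conjE Im_conj.
Qed.

End WignerParts.

(** * The convolution with delta, the Moyal identity and temperedness *)

Section Final.
Context {R : realType}.
Local Notation leb := (@lebesgue_measure R).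
Local Notation leb2 := (leb \x leb)%E.
Local Notation intg f := (leb.-integrable setT (EFin \o f)).
Local Notation intg2 f := (leb2.-integrable setT (EFin \o f)).

Lemma cintegral_conj d (T : measurableType d) (mu : {measure set T -> \bar R})
    (D : set T) (f : T -> R[i]) :
  conjc (cintegral mu D f) = cintegral mu D (fun t => conjc (f t)).
Proof.
rewrite /cintegral /=; congr (_ +i* _).
  by apply: eq_Rintegral => t _; rewrite Re_conj.
rewrite (Rintegral_mkcond _ D) [RHS]Rintegral_mkcond -RintegralN.
apply: eq_Rintegral => t _; rewrite !patchE.
by case: ifPn => _; rewrite ?Im_conj// oppr0.
Qed.

(** The left translate of p by the identity is p, so both functionals
integrate conj(h) against g; what differs is the place of the complex
conjugation. *)
Lemma weyl_quant_conv (g : R * R -> R[i]) (psi phi : R -> R[i]) :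
  weyl_quant (functional_of g) psi phi = conv_fun_parity g psi phi.
Proof.
rewrite /weyl_quant /conv_fun_parity /weyl_quant /conv_symbol /delta_one.
rewrite /functional_of /aff_integral cintegral_conj; congr (cintegral _ _ _).
apply/funext => -[x a] /=.
rewrite /rtrans /aff_mul /aff_one /= !mul1r addr0.
by apply: eq_complexP; rewrite !complexE /=; ring.
Qed.

Lemma aff_integral_log (F : R * R -> R[i]) (fr fi : R * R -> R) :
  measurable_fun setT fr -> measurable_fun setT fi ->
  (forall z, F (z.1, expR z.2) = fr z +i* fi z) ->
  aff_integral F = (\int[leb2]_z fr z) +i* (\int[leb2]_z fi z).
Proof.
move=> mr mi FE; rewrite /aff_integral /cintegral; congr (_ +i* _).
  rewrite /Rintegral; congr fine.
  transitivity (\int[leb2]_(p in Aff) (complex.Re (F p) * p.2^-1)%:E)%E.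
    by apply: eq_integral => p _; rewrite Re_mul /= mulr0 subr0.
  rewrite (integral_Aff (f := fun p => complex.Re (F p))).
    by apply: eq_integral => z _; rewrite FE.
  by under eq_fun do rewrite FE.
rewrite /Rintegral; congr fine.
transitivity (\int[leb2]_(p in Aff) (complex.Im (F p) * p.2^-1)%:E)%E.
  by apply: eq_integral => p _; rewrite Im_mul /= mulr0 add0r.
rewrite (integral_Aff (f := fun p => complex.Im (F p))).
  by apply: eq_integral => z _; rewrite FE.
by under eq_fun do rewrite FE.
Qed.

Lemma inner_Rpos_log (f g : R -> R[i]) (fr fi : R -> R) :
  measurable_fun setT fr -> measurable_fun setT fi ->
  (forall t, f (expR t) * conjc (g (expR t)) = fr t +i* fi t) ->
  inner_Rpos f g = (\int[leb]_t fr t) +i* (\int[leb]_t fi t).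
Proof.
move=> mr mi FE; rewrite /inner_Rpos /cintegral; congr (_ +i* _).
  rewrite /Rintegral; congr fine.
  rewrite (integral_ln (f := EFin \o fr)); last exact/measurable_EFinP.
  apply: eq_integral => r; rewrite inE/= => r0.
  by rewrite Re_mul /= mulr0 subr0 -{1 2}(lnK (r0 : r \in Num.pos)) FE.
rewrite /Rintegral; congr fine.
rewrite (integral_ln (f := EFin \o fi)); last exact/measurable_EFinP.
apply: eq_integral => r; rewrite inE/= => r0.
by rewrite Im_mul /= mulr0 add0r -{1 2}(lnK (r0 : r \in Num.pos)) FE.
Qed.

Lemma integrable_cross_bounded (F : R * R -> R) (a : R * R -> R) (M : R) :
  measurable_fun setT F -> (forall z, `|F z| <= M) -> intg2 a ->
  intg2 (fun z => F z * a z).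
Proof.
move=> mF FM ia; have := @integrable_mul_bounded _ _ _ leb2 _ _ _ mF FM ia.
by congr (integrable _ _ _); apply/funext => z /=; rewrite mulrC.
Qed.

(** The shape that products of two Wigner transforms take once expanded: two
Plancherel pairs and four cross terms. *)
Lemma Rintegral_mod_null (p q a b c d : R * R -> R) :
  intg2 p -> intg2 q -> intg2 a -> intg2 b -> intg2 c -> intg2 d ->
  \int[leb2]_z a z = 0 -> \int[leb2]_z b z = 0 ->
  \int[leb2]_z c z = 0 -> \int[leb2]_z d z = 0 ->
  \int[leb2]_z (p z + q z + (a z + b z) - (c z + d z)) =
  \int[leb2]_z p z + \int[leb2]_z q z.
Proof.
move=> ip iq ia ib ic id za zb zc zd.
have ipq := integrable_add ip iq; have iab := integrable_add ia ib.
have icd := integrable_add ic id.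
rewrite (RintegralB measurableT (integrable_add ipq iab) icd).
rewrite (RintegralD measurableT ipq iab) (RintegralD measurableT ip iq).
rewrite (RintegralD measurableT ia ib) (RintegralD measurableT ic id).
by rewrite za zb zc zd !addr0 subr0.
Qed.

Lemma moyal_Re (K1 K2 L1 L2 : R * R -> R) :
  tame K1 -> tame K2 -> tame L1 -> tame L2 ->
  \int[leb2]_z ((cosT K1 z + sinT K2 z) * (cosT L1 z + sinT L2 z) +
    (cosT K2 z - sinT K1 z) * (cosT L2 z - sinT L1 z)) =
  \int[leb2]_z (K1 z * L1 z) + \int[leb2]_z (K2 z * L2 z).
Proof.
move=> n1 n2 m1 m2; rewrite -!plancherel2//.
have iP K L : tame K -> tame L -> intg2 (fun z => cosT K z * cosT L z + sinT K z * sinT L z).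
  move=> nK nL; apply: integrable_add.
    exact: (trig_mul_integrable false false nK nL).
  exact: (trig_mul_integrable true true nK nL).
have iX K L : tame K -> tame L -> intg2 (fun z => cosT K z * sinT L z).
  by move=> nK nL; exact: (trig_mul_integrable false true nK nL).
rewrite -(@Rintegral_mod_null _ _ (fun z => cosT K1 z * sinT L2 z)
  (fun z => cosT L1 z * sinT K2 z) (fun z => cosT K2 z * sinT L1 z)
  (fun z => cosT L2 z * sinT K1 z)) ?plancherel2_cross//; try exact: iP; try exact: iX.
by apply: eq_Rintegral => z _; ring.
Qed.

(** Multiplying the first kernel by - i replaces (K1, K2) by (K2, - K1) and
turns the imaginary part of the product into its real part. *)
Lemma moyal_Im (K1 K2 L1 L2 : R * R -> R) :
  tame K1 -> tame K2 -> tame L1 -> tame L2 ->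
  \int[leb2]_z ((cosT K2 z - sinT K1 z) * (cosT L1 z + sinT L2 z) -
    (cosT K1 z + sinT K2 z) * (cosT L2 z - sinT L1 z)) =
  \int[leb2]_z (K2 z * L1 z) - \int[leb2]_z (K1 z * L2 z).
Proof.
move=> n1 n2 m1 m2.
have nN := tameN n1.
have -> : - (\int[leb2]_z (K1 z * L2 z)) = \int[leb2]_z (- K1 z * L2 z).
  by rewrite -RintegralN; apply: eq_Rintegral => z _; rewrite mulNr.
rewrite -(moyal_Re n2 nN m1 m2); apply: eq_Rintegral => z _.
have -> : cosT (fun z => - K1 z) z = - cosT K1 z.
  by rewrite /cosT /cos_transform -RintegralN; apply: eq_Rintegral => u _; rewrite mulNr.
have -> : sinT (fun z => - K1 z) z = - sinT K1 z.
  by rewrite /sinT /sin_transform -RintegralN; apply: eq_Rintegral => u _; rewrite mulNr.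
by ring.
Qed.

(** With [pairIm], the function f(e^t) conj(g(e^t)). *)
Definition pairRe (f g : R -> R[i]) (t : R) : R :=
  logRe f t * logRe g t + logIm f t * logIm g t.
Definition pairIm (f g : R -> R[i]) (t : R) : R :=
  logIm f t * logRe g t - logRe f t * logIm g t.

Lemma decaying_pairRe f g : schwartz_Rpos f -> schwartz_Rpos g -> decaying (pairRe f g).
Proof.
by move=> /schwartz_decaying[? ?] /schwartz_decaying[? ?];
  apply: decayingD; exact: decayingM.
Qed.

Lemma decaying_pairIm f g : schwartz_Rpos f -> schwartz_Rpos g -> decaying (pairIm f g).
Proof.
by move=> /schwartz_decaying[? ?] /schwartz_decaying[? ?];
  apply: decayingD; [|apply: decayingN]; exact: decayingM.
Qed.

Lemma inner_RposE (f g : R -> R[i]) : schwartz_Rpos f -> schwartz_Rpos g ->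
  inner_Rpos f g = (\int[leb]_t pairRe f g t) +i* (\int[leb]_t pairIm f g t).
Proof.
move=> sf sg; apply: inner_Rpos_log.
- exact: decaying_measurable (decaying_pairRe sf sg).
- exact: decaying_measurable (decaying_pairIm sf sg).
- by move=> t; apply: eq_complexP; rewrite !complexE /= /pairRe /pairIm /logRe /logIm; ring.
Qed.

Lemma inner_Rpos_scale (c : R[i]) (f g : R -> R[i]) :
  schwartz_Rpos f -> schwartz_Rpos g ->
  inner_Rpos (fun r => c * f r) g = c * inner_Rpos f g.
Proof.
move=> sf sg.
have dR := decaying_pairRe sf sg; have dI := decaying_pairIm sf sg.
have mR := decaying_measurable dR; have mI := decaying_measurable dI.
have iR := decaying_integrable dR; have iI := decaying_integrable dI.
rewrite (inner_RposE sf sg) (@inner_Rpos_log (fun r => c * f r) g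
  (fun t => complex.Re c * pairRe f g t - complex.Im c * pairIm f g t)
  (fun t => complex.Re c * pairIm f g t + complex.Im c * pairRe f g t)).
- rewrite (RintegralB measurableT (integrable_scale _ iR) (integrable_scale _ iI)).
  rewrite (RintegralD measurableT (integrable_scale _ iI) (integrable_scale _ iR)).
  rewrite !(RintegralZl _ measurableT iR) !(RintegralZl _ measurableT iI).
  by apply: eq_complexP; rewrite !complexE.
- by apply: measurable_funB; exact: measurable_funM.
- by apply: measurable_funD; exact: measurable_funM.
- move=> t; apply: eq_complexP; rewrite !complexE /= /pairRe /pairIm /logRe /logIm; ring.
Qed.

(** By Plancherel the pairing is the integral of K conj(L), where K and L are
the kernels of the two Wigner transforms; this product is the shear of (psi
conj(eta)) (x) (xi conj(phi)). *)
Lemma moyal (psi phi eta xi : R -> R[i]) :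
  schwartz_Rpos psi -> schwartz_Rpos phi ->
  schwartz_Rpos eta -> schwartz_Rpos xi ->
  functional_of (wigner psi phi) (wigner eta xi) =
  inner_Rpos psi eta * inner_Rpos xi phi.
Proof.
move=> spsi sphi seta sxi.
have nR := tame_kerRe spsi sphi; have nI := tame_kerIm spsi sphi.
have w1 := measurable_wigRe spsi sphi; have w2 := measurable_wigIm spsi sphi.
have w3 := measurable_wigRe seta sxi; have w4 := measurable_wigIm seta sxi.
have mR := tame_kerRe seta sxi; have mI := tame_kerIm seta sxi.
rewrite /functional_of (@aff_integral_log _
  (fun z => wigRe psi phi z * wigRe eta xi z + wigIm psi phi z * wigIm eta xi z)
  (fun z => wigIm psi phi z * wigRe eta xi z - wigRe psi phi z * wigIm eta xi z)); last 3 first.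
- exact: (measurable_funD (measurable_funM w1 w3) (measurable_funM w2 w4)).
- exact: (measurable_funB (measurable_funM w2 w3) (measurable_funM w1 w4)).
- by move=> z; rewrite !wigner_log//; apply: eq_complexP; rewrite !complexE /=; ring.
rewrite moyal_Re// moyal_Im// !inner_RposE//.
have aR := decaying_pairRe spsi seta; have aI := decaying_pairIm spsi seta.
have bR := decaying_pairRe sxi sphi; have bI := decaying_pairIm sxi sphi.
have tw a b : decaying a -> decaying b ->
    intg2 (twist loglam a b) /\
    \int[leb2]_z twist loglam a b z = \int[leb]_p a p * \int[leb]_q b q.
  move=> da db; split; last exact: Rintegral_twist continuous_loglam da db.
  exact: tame_integrable (tame_twist continuous_loglam da db).
have [i1 e1] := tw _ _ aR bR; have [i2 e2] := tw _ _ aI bI.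
have [i3 e3] := tw _ _ aR bI; have [i4 e4] := tw _ _ aI bR.
apply: eq_complexP; rewrite !complexE /= -?e1 -?e2 -?e3 -?e4.
  rewrite -RintegralD//; [|exact: tame_mul_integrable|exact: tame_mul_integrable].
  rewrite -RintegralB//; apply: eq_Rintegral => z _.
  by rewrite /kerRe /kerIm /twist /pairRe /pairIm; ring.
rewrite -RintegralB//; [|exact: tame_mul_integrable|exact: tame_mul_integrable].
rewrite -RintegralD//; apply: eq_Rintegral => z _.
by rewrite /kerRe /kerIm /twist /pairRe /pairIm; ring.
Qed.

Lemma rank_one_weyl (psi phi : R -> R[i]) : schwartz_Rpos psi -> schwartz_Rpos phi ->
  eq_operator (rank_one psi phi) (weyl_quant (functional_of (wigner psi phi))).
Proof.
move=> spsi sphi xi eta sxi seta.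
by rewrite /weyl_quant moyal// /rank_one inner_Rpos_scale// mulrC.
Qed.

Definition lorentz2 (z : R * R) : R := lorentz z.1 * lorentz z.2.

Lemma lorentz2_integrable : intg2 lorentz2.
Proof. by apply: integrable_prodM; exact: integrable_lorentz. Qed.

(** Expand (1 + x^2) (1 + y^2): each of the four terms is bounded by one
seminorm. *)
Lemma seminorm_lorentz2 (f : R * R -> R[i]) (C1 C2 C3 C4 : R) :
  seminorm2_le 0 0 0 0 f C1 -> seminorm2_le 2 0 0 0 f C2 ->
  seminorm2_le 0 2 0 0 f C3 -> seminorm2_le 2 2 0 0 f C4 ->
  forall z, Normc.normc (f z) <= (C1 + C2 + C3 + C4) * lorentz2 z.
Proof.
move=> h1 h2 h3 h4 [x y]; rewrite /lorentz2 /lorentz /= -invfM.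
rewrite ler_pdivlMr; last by apply: mulr_gt0; rewrite ltr_pwDl// sqr_ge0.
have := h1 x y; have := h2 x y; have := h3 x y; have := h4 x y.
rewrite /= !expr0 !mul1r !mulr1 !real_normK ?num_real//.
by set N := Normc.normc _; move=> *; rewrite mulrDl !mulrDr; lra.
Qed.

Definition logRe2 (h : R * R -> R[i]) (z : R * R) : R := complex.Re (h (z.1, expR z.2)).
Definition logIm2 (h : R * R -> R[i]) (z : R * R) : R := complex.Im (h (z.1, expR z.2)).

Lemma schwartz_Aff_measurable (h : R * R -> R[i]) : schwartz_Aff h ->
  measurable_fun setT (logRe2 h) /\ measurable_fun setT (logIm2 h).
Proof.
move=> [_ [sm _]]; split; apply: continuous_measurable_fun2 => z;
  by have [] := sm [::] z I.
Qed.

Lemma schwartz_Aff_integrable (h : R * R -> R[i]) : schwartz_Aff h ->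
  intg2 (logRe2 h) /\ intg2 (logIm2 h).
Proof.
move=> sh; have [mr mi] := schwartz_Aff_measurable sh.
have [_ [_ bd]] := sh.
have [C1 h1] := bd 0%N 0%N 0%N 0%N; have [C2 h2] := bd 2%N 0%N 0%N 0%N.
have [C3 h3] := bd 0%N 2%N 0%N 0%N; have [C4 h4] := bd 2%N 2%N 0%N 0%N.
have hb := seminorm_lorentz2 h1 h2 h3 h4.
have ir := integrable_scale (C1 + C2 + C3 + C4) lorentz2_integrable.
split; apply: (integrable_le _ _ ir) => // z.
  by rewrite (le_trans (normc_ge_Re _))//; exact: hb.
by rewrite (le_trans (normc_ge_Im _))//; exact: hb.
Qed.

Lemma functional_of_log (psi phi : R -> R[i]) (h : R * R -> R[i]) :
  schwartz_Rpos psi -> schwartz_Rpos phi ->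
  measurable_fun setT (logRe2 h) -> measurable_fun setT (logIm2 h) ->
  functional_of (wigner psi phi) h =
  (\int[leb2]_z (wigRe psi phi z * logRe2 h z + wigIm psi phi z * logIm2 h z)) +i*
  (\int[leb2]_z (wigIm psi phi z * logRe2 h z - wigRe psi phi z * logIm2 h z)).
Proof.
move=> spsi sphi mr mi.
have w1 := measurable_wigRe spsi sphi; have w2 := measurable_wigIm spsi sphi.
apply: aff_integral_log.
- exact: (measurable_funD (measurable_funM w1 mr) (measurable_funM w2 mi)).
- exact: (measurable_funB (measurable_funM w2 mr) (measurable_funM w1 mi)).
- move=> z; rewrite wigner_log//.
  by apply: eq_complexP; rewrite !complexE /= /logRe2 /logIm2; ring.
Qed.

Section Tempered.
Variables psi phi : R -> R[i].
Hypotheses (spsi : schwartz_Rpos psi) (sphi : schwartz_Rpos phi).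

Let wI (a : R * R -> R) : intg2 a ->
  intg2 (fun z => wigRe psi phi z * a z) /\ intg2 (fun z => wigIm psi phi z * a z).
Proof.
move=> ia; have [M [_ hM]] := wig_bounded spsi sphi.
split; apply: (@integrable_cross_bounded _ _ M) => //.
- exact: measurable_wigRe.
- by move=> z; have [] := hM z.
- exact: measurable_wigIm.
- by move=> z; have [] := hM z.
Qed.

Lemma functional_of_comb (c : R[i]) (h1 h2 : R * R -> R[i]) :
  schwartz_Aff h1 -> schwartz_Aff h2 ->
  functional_of (wigner psi phi) (fun p => c * h1 p + h2 p) =
  conjc c * functional_of (wigner psi phi) h1 + functional_of (wigner psi phi) h2.
Proof.
move=> s1 s2.
have [m1r m1i] := schwartz_Aff_measurable s1.
have [m2r m2i] := schwartz_Aff_measurable s2.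
have [i1r i1i] := schwartz_Aff_integrable s1.
have [i2r i2i] := schwartz_Aff_integrable s2.
have eR : logRe2 (fun p => c * h1 p + h2 p) = (fun z =>
    complex.Re c * logRe2 h1 z - complex.Im c * logIm2 h1 z + logRe2 h2 z).
  by apply/funext => z; rewrite /logRe2 /logIm2 !complexE.
have eI : logIm2 (fun p => c * h1 p + h2 p) = (fun z =>
    complex.Re c * logIm2 h1 z + complex.Im c * logRe2 h1 z + logIm2 h2 z).
  by apply/funext => z; rewrite /logRe2 /logIm2 !complexE.
rewrite !functional_of_log//; last 2 first.
- rewrite eR; apply: measurable_funD => //.
  by apply: measurable_funB; exact: measurable_funM.
- rewrite eI; apply: measurable_funD => //.
  by apply: measurable_funD; exact: measurable_funM.
have [a1 b1] := wI i1r; have [a2 b2] := wI i1i.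
have [a3 b3] := wI i2r; have [a4 b4] := wI i2i.
have p1 := integrable_add a1 b2; have q1 := integrable_sub b1 a2.
have p2 := integrable_add a3 b4; have q2 := integrable_sub b3 a4.
set cr := complex.Re c; set ci := complex.Im c.
apply: eq_complexP; rewrite !complexE /= eR eI -/cr -/ci.
  rewrite mulNr opprK -(RintegralZl cr measurableT p1) -(RintegralZl ci measurableT q1).
  have k1 := integrable_scale cr p1; have k2 := integrable_scale ci q1.
  rewrite -(RintegralD measurableT k1 k2).
  rewrite -(RintegralD measurableT (integrable_add k1 k2) p2).
  by apply: eq_Rintegral => z _; ring.
rewrite mulNr -(RintegralZl cr measurableT q1) -(RintegralZl ci measurableT p1).
have k1 := integrable_scale cr q1; have k2 := integrable_scale ci p1.
rewrite -(RintegralB measurableT k1 k2).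
rewrite -(RintegralD measurableT (integrable_sub k1 k2) q2).
by apply: eq_Rintegral => z _; ring.
Qed.

(** The Wigner transform is bounded by some M in each part, so the pairing
with h - h0 is at most a multiple of M times the integral of the majorant of h
- h0. *)
Lemma tempered_wigner : tempered_Aff (functional_of (wigner psi phi)).
Proof.
split; first by move=> c h1 h2 s1 s2; exact: functional_of_comb.
move=> h0 s0 eps eps0.
have [M [M0 hM]] := wig_bounded spsi sphi.
have l0 z : 0 <= lorentz2 z by rewrite /lorentz2 mulr_ge0 ?lorentz_ge0.
have S0 : 0 <= \int[leb2]_z lorentz2 z by exact: Rintegral_ge0.
(* four seminorms, two products in each of the real and imaginary parts, and
two parts: 4 * 2 * 2 = 16; the summand 1 keeps B positive *)
pose B := 16 * (M * \int[leb2]_z lorentz2 z) + 1.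
have B0 : 0 < B by rewrite ltr_wpDl// !mulr_ge0.
exists 2%N, (eps / B); split; first exact: divr_gt0.
move=> h sh hs.
have hb := seminorm_lorentz2 (hs 0%N 0%N 0%N 0%N isT isT isT isT)
  (hs 2%N 0%N 0%N 0%N isT isT isT isT) (hs 0%N 2%N 0%N 0%N isT isT isT isT)
  (hs 2%N 2%N 0%N 0%N isT isT isT isT).
set d := eps / B in hb.
have d0 : 0 <= d by rewrite divr_ge0 ?ltW.
have dE : functional_of (wigner psi phi) h - functional_of (wigner psi phi) h0 =
    functional_of (wigner psi phi) (fun p => h p - h0 p).
  have := functional_of_comb (-1) s0 sh.
  have -> : (fun p => -1 * h0 p + h p) = (fun p => h p - h0 p).
    by apply/funext => p; rewrite mulN1r addrC.
  move=> ->; rewrite addrC; congr (_ + _).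
  by apply: eq_complexP; rewrite !complexE /=; ring.
have [mr mi] := schwartz_Aff_measurable sh.
have [mr0 mi0] := schwartz_Aff_measurable s0.
have er : logRe2 (fun p => h p - h0 p) = (fun z => logRe2 h z - logRe2 h0 z).
  by apply/funext => z; rewrite /logRe2 !complexE.
have ei : logIm2 (fun p => h p - h0 p) = (fun z => logIm2 h z - logIm2 h0 z).
  by apply/funext => z; rewrite /logIm2 !complexE.
have mdr : measurable_fun setT (logRe2 (fun p => h p - h0 p)).
  by rewrite er; exact: measurable_funB.
have mdi : measurable_fun setT (logIm2 (fun p => h p - h0 p)).
  by rewrite ei; exact: measurable_funB.
have w1 := measurable_wigRe spsi sphi; have w2 := measurable_wigIm spsi sphi.
rewrite dE functional_of_log// (le_trans (normc_le_ReIm _))//=.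
pose g z := 8 * M * d * lorentz2 z.
have ig : intg2 g by apply: integrable_scale; exact: lorentz2_integrable.
have bound (u v a b : R) z : `|u| <= M -> `|v| <= M -> `|a| <= 4 * d * lorentz2 z ->
    `|b| <= 4 * d * lorentz2 z -> `|u * a + v * b| <= g z.
  move=> hu hv ha hb'; rewrite (le_trans (ler_normD _ _))// !normrM.
  have -> : g z = M * (4 * d * lorentz2 z) + M * (4 * d * lorentz2 z) by rewrite /g; ring.
  by rewrite lerD// ler_pM.
have hr z : `|logRe2 (fun p => h p - h0 p) z| <= 4 * d * lorentz2 z.
  rewrite (le_trans (normc_ge_Re _))// (le_trans (hb z))//.
  by rewrite ler_wpM2r//; lra.
have hi z : `|logIm2 (fun p => h p - h0 p) z| <= 4 * d * lorentz2 z.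
  rewrite (le_trans (normc_ge_Im _))// (le_trans (hb z))//.
  by rewrite ler_wpM2r//; lra.
have G : \int[leb2]_z g z <= eps / 2.
  rewrite /g (RintegralZl _ measurableT lorentz2_integrable).
  have -> : 8 * M * d * (\int[leb2]_z lorentz2 z) = d * (B - 1) / 2.
    by rewrite /B addrK; field.
  rewrite ler_pM2r// mulrBr mulr1 /d divfK ?gt_eqF// lerBlDr lerDl//.
rewrite (splitr eps) lerD//.
  apply: (le_trans _ G); apply: normr_Rintegral_le => //.
    exact: (measurable_funD (measurable_funM w1 mdr) (measurable_funM w2 mdi)).
  by move=> z; have [u1 u2] := hM z; exact: bound.
apply: (le_trans _ G); apply: normr_Rintegral_le => //.
  exact: (measurable_funB (measurable_funM w2 mdr) (measurable_funM w1 mdi)).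
by move=> z; have [u1 u2] := hM z; rewrite -mulNr; apply: bound; rewrite ?normrN.
Qed.

End Tempered.

End Final.

Theorem theorem3 (R : realType) :
  (forall g : R * R -> R[i], schwartz_Aff g ->
     eq_operator (weyl_quant (functional_of g)) (conv_fun_parity g))
  /\
  (forall phi psi : R -> R[i], schwartz_Rpos phi -> schwartz_Rpos psi ->
     is_weyl_symbol (functional_of (wigner psi phi)) (rank_one psi phi)
     /\ forall (x a : R), 0 < a ->
          wigner psi phi (x, a) = conv_rank_one_parity psi phi (x, a)).
Proof.
split; first by move=> g _ psi phi _ _; exact: weyl_quant_conv.
move=> phi psi sphi spsi; split; last by move=> x a a0; exact: wigner_parity.
by split; [exact: tempered_wigner|exact: rank_one_weyl].
Qed.
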